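(* Let $\lambda$ and $\nu$ be $n$-cores. Then $(\lambda,\nu)$ is a horizontal strong strip if and only if $w_\nu w_\lambda^{-1}$ is a cyclically decreasing element of $\tilde S_n$ with $\ell(w_\nu)=\ell(w_\lambda)+\ell(w_\nu w_\lambda^{-1})$.
   Context: Fix $n\ge2$. $\tilde S_n$ is the affine symmetric group with generators $s_0,\dots,s_{n-1}$ (indices mod $n$), relations $s_i^2=1$, $s_is_{i+1}s_i=s_{i+1}s_is_{i+1}$, $s_is_j=s_js_i$ for $i-j\not\equiv\pm1\pmod n$; $\ell$ is the length. $\tilde S_n^0$ is the set of minimal length coset representatives of $\tilde S_n/\langle s_1,\dots,s_{n-1}\rangle$. A word in $\mathbb Z/n\mathbb Z$ is cyclically decreasing if each letter occurs at most once and $i+1$ precedes $i$ whenever both occur; an element is cyclically decreasing if it has a cyclically decreasing reduced word. Partitions are drawn in French convention ($\lambda_1$ is the bottom row); the cell in row $i$, column $j$ has $n$-residue $j-i\bmod n$. An $n$-core is a partition with no cell of hook length $n$. For an $n$-core with an addable corner of residue $i$, $s_i$ acts by adding all addable corners of residue $i$; this yields a bijection $\mathfrak a:\tilde S_n^0\to\{n\text{-cores}\}$, $\mathfrak a(w)=s_{i_1}\cdots s_{i_\ell}\emptyset$ for any reduced word; write $w_\mu=\mathfrak a^{-1}(\mu)$ and $\deg(\mu)=\ell(w_\mu)$. For $n$-cores, $\mu\lessdot_B\gamma$ means $\mu\subset\gamma$ and $\deg\gamma=\deg\mu+1$. For an $n$-core $\lambda$, $R(n-1,\lambda)=(\lambda_1+n-1,\lambda_1,\lambda_2,\dots)$.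 The pair $(\lambda,\nu)$ is a horizontal strong strip (of length $m=n-1+\deg(\lambda)-\deg(\nu)$) if $\lambda\subset\nu$ and there is a saturated chain $\nu=\nu^{(0)}\lessdot_B\nu^{(1)}\lessdot_B\cdots\lessdot_B\nu^{(m)}=R(n-1,\lambda)$ such that the bottom row of $\nu^{(i)}$ is strictly longer than the bottom row of $\nu^{(i-1)}$ for $1\le i\le m$.
   Formalization: For n = 2 the braid relation is dropped, so that the affine symmetric group is infinite dihedral; with the braid relation as written the group would be the finite S_3 and the bijection with the 2-cores would fail. *)

(* Defs.v *)
From HB Require Import structures.
From mathcomp Require Import all_boot.
From mathcomp Require Import boolp classical_sets.

Set Implicit Arguments.
Unset Strict Implicit.
Unset Printing Implicit Defensive.

(* Congruence on words generated by the Coxeter relations of type A_{n-1}^(1);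
   ordS is the cyclic successor i |-> i + 1 mod n on 'I_n. As s_i^2 = 1 makes
   every generator invertible, the monoid so presented is the presented group.
   For n = 2 there is no braid relation (the group is infinite dihedral). *)
Inductive cox_equiv (n : nat) : seq 'I_n -> seq 'I_n -> Prop :=
| cox_refl u : cox_equiv u u
| cox_sym u v : cox_equiv u v -> cox_equiv v u
| cox_trans v u w : cox_equiv u v -> cox_equiv v w -> cox_equiv u w
| cox_cat u u' v v' :
    cox_equiv u u' -> cox_equiv v v' -> cox_equiv (u ++ v) (u' ++ v')
| cox_sq i : cox_equiv [:: i; i] [::]
| cox_braid i : 2 < n ->
    cox_equiv [:: i; ordS i; i] [:: ordS i; i; ordS i]
| cox_comm i j : j != ordS i -> i != ordS j ->
    cox_equiv [:: i; j] [:: j; i].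

Definition cox_equivb (n : nat) : rel (seq 'I_n) :=
  fun u v => `[< cox_equiv u v >].

Lemma cox_equivb_refl n : reflexive (@cox_equivb n).
Proof. by move=> u; apply/asboolP; exact: cox_refl. Qed.

Lemma cox_equivb_sym n : symmetric (@cox_equivb n).
Proof. by move=> u v; apply/asboolP/asboolP; exact: cox_sym. Qed.

Lemma cox_equivb_trans n : transitive (@cox_equivb n).
Proof.
by move=> v u w /asboolP uv /asboolP vw; apply/asboolP; exact: cox_trans uv vw.
Qed.

Canonical cox_equiv_rel (n : nat) :=
  EquivRel (@cox_equivb n)
    (@cox_equivb_refl n) (@cox_equivb_sym n) (@cox_equivb_trans n).

(* The affine symmetric group. *)
Definition affS (n : nat) := {eq_quot (cox_equiv_rel n)}%qT.

HB.instance Definition _ n := Choice.on (affS n).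
HB.instance Definition _ n := EqQuotient.on (affS n).

(* The element s_{i_1} * ... * s_{i_k} of the word [:: i_1; ...; i_k]. *)
Definition word_elt (n : nat) (u : seq 'I_n) : affS n := \pi_(affS n)%qT u.

Lemma word_eltP n (u v : seq 'I_n) : word_elt u = word_elt v <-> cox_equiv u v.
Proof. by split=> [/eqmodP/asboolP|uv]; last exact/eqmodP/asboolP. Qed.

Lemma word_elt_repr n (w : affS n) : word_elt (repr w) = w.
Proof. exact: reprK. Qed.

Definition affS_one (n : nat) : affS n := word_elt [::].
Definition affS_mul (n : nat) (v w : affS n) : affS n :=
  word_elt (repr v ++ repr w).
Definition affS_inv (n : nat) (w : affS n) : affS n := word_elt (rev (repr w)).

Lemma affS_mulE n (u v : seq 'I_n) :
  affS_mul (word_elt u) (word_elt v) = word_elt (u ++ v).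
Proof. by apply/word_eltP/cox_cat; apply/word_eltP; exact: word_elt_repr. Qed.

Lemma cox_rev_cat n (u : seq 'I_n) : cox_equiv (rev u ++ u) [::].
Proof.
elim: u => [|i u IH]; first exact: cox_refl.
rewrite rev_cons -cats1 -catA -[[:: i] ++ i :: u]/([:: i; i] ++ u).
apply: cox_trans IH; apply: cox_cat; first exact: cox_refl.
by rewrite -{2}[u]cat0s; apply: cox_cat; [exact: cox_sq | exact: cox_refl].
Qed.

Fact affS_mulA n : associative (@affS_mul n).
Proof.
move=> u v w; rewrite -(word_elt_repr u) -(word_elt_repr v) -(word_elt_repr w).
by rewrite !affS_mulE catA.
Qed.

Fact affS_mul1g n : left_id (affS_one n) (@affS_mul n).
Proof. by move=> w; rewrite -(word_elt_repr w) affS_mulE. Qed.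

Fact affS_mulg1 n : right_id (affS_one n) (@affS_mul n).
Proof. by move=> w; rewrite -(word_elt_repr w) affS_mulE cats0. Qed.

Fact affS_mulVg n : left_inverse (affS_one n) (@affS_inv n) (@affS_mul n).
Proof.
move=> w; rewrite -{2}(word_elt_repr w) affS_mulE.
by apply/word_eltP; exact: cox_rev_cat.
Qed.

Fact affS_mulgV n : right_inverse (affS_one n) (@affS_inv n) (@affS_mul n).
Proof.
move=> w; rewrite -{1}(word_elt_repr w) affS_mulE.
by apply/word_eltP; rewrite -{1}(revK (repr w)); exact: cox_rev_cat.
Qed.

HB.instance Definition _ n := isGroup.Build (affS n)
  (@affS_mulA n) (@affS_mul1g n) (@affS_mulg1 n) (@affS_mulVg n)
  (@affS_mulgV n).

Lemma affS_has_word n (w : affS n) :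
  exists k, [exists t : k.-tuple 'I_n, word_elt t == w].
Proof.
exists (size (repr w)); apply/existsP; exists (in_tuple (repr w)).
by rewrite /= word_elt_repr.
Qed.

Definition len (n : nat) (w : affS n) : nat := ex_minn (affS_has_word w).

Definition reduced_word (n : nat) (w : affS n) (u : seq 'I_n) : Prop :=
  word_elt u = w /\ size u = len w.

(* Membership in the subgroup generated by s_1, ..., s_{n-1}. *)
Definition in_parabolic (n : nat) (p : affS n) : Prop :=
  exists2 u : seq 'I_n, all (fun i : 'I_n => val i != 0) u & word_elt u = p.

Definition min_coset_rep (n : nat) (w : affS n) : Prop :=
  forall p : affS n, in_parabolic p -> len w <= len (w * p)%g.

Definition cyc_decreasing_word (n : nat) (u : seq 'I_n) : Prop :=
  uniq u /\ forall i : 'I_n, i \in u -> ordS i \in u ->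
    index (ordS i) u < index i u.

Definition cyc_decreasing (n : nat) (w : affS n) : Prop :=
  exists2 u, reduced_word w u & cyc_decreasing_word u.

(* Partitions are weakly decreasing lists of positive integers. Rows and
   columns are counted from 0, row 0 being the bottom one, so that row i has
   length nth 0 la i. *)
Definition is_part (la : seq nat) : bool := sorted geq la && (0 \notin la).

Definition subpart (mu la : seq nat) : Prop :=
  forall i, nth 0 mu i <= nth 0 la i.

Definition arm (la : seq nat) (i j : nat) : nat := nth 0 la i - j.+1.

Definition leg (la : seq nat) (i j : nat) : nat :=
  count (fun part => j < part) la - i.+1.

Definition hook (la : seq nat) (i j : nat) : nat := arm la i j + leg la i j + 1.

Definition is_core (n : nat) (la : seq nat) : Prop :=
  is_part la /\ forall i j, j < nth 0 la i -> hook la i j != n.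

(* The cell in row i, column j has residue r, that is j - i = r mod n. *)
Definition has_residue (n : nat) (r : 'I_n) (i j : nat) : bool :=
  j == i + r %[mod n].

(* The corner which can be added to, resp. removed from, row i exists and has
   residue r. *)
Definition addable (n : nat) (r : 'I_n) (la : seq nat) (i : nat) : bool :=
  ((i == 0) || (nth 0 la i < nth 0 la i.-1)) && has_residue r i (nth 0 la i).

Definition removable (n : nat) (r : 'I_n) (la : seq nat) (i : nat) : bool :=
  (nth 0 la i.+1 < nth 0 la i) && has_residue r i (nth 0 la i).-1.

Definition add_corners (n : nat) (r : 'I_n) (la : seq nat) : seq nat :=
  [seq part <- mkseq (fun i => nth 0 la i + addable r la i) (size la).+1
             | part != 0].

Definition remove_corners (n : nat) (r : 'I_n) (la : seq nat) : seq nat :=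
  [seq part <- mkseq (fun i => nth 0 la i - removable r la i) (size la)
             | part != 0].

(* The action of s_r on n-cores. The second branch, which completes the rule
   for cores with an addable corner of residue r to an action of the whole
   group, is never used when a reduced word of a minimal length coset
   representative is applied to the empty core. *)
Definition core_act (n : nat) (r : 'I_n) (la : seq nat) : seq nat :=
  if has (addable r la) (iota 0 (size la).+1) then add_corners r la
  else remove_corners r la.

Definition core_act_word (n : nat) (u : seq 'I_n) (la : seq nat) : seq nat :=
  foldr (@core_act n) la u.

(* w is a minimal length coset representative and a(w) = mu, where a is the
   bijection onto n-cores; the value a(w) does not depend on the reduced word. *)
Definition core_map (n : nat) (w : affS n) (mu : seq nat) : Prop :=
  min_coset_rep w /\
  exists2 u, reduced_word w u & core_act_word u [::] = mu.

(* w_mu = a^{-1}(mu); the default value 1 is irrelevant on n-cores, for which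
   the element exists and is unique. *)
Definition core_elt (n : nat) (mu : seq nat) : affS n :=
  xget 1%g [set w : affS n | core_map w mu]%classic.

Definition core_deg (n : nat) (mu : seq nat) : nat := len (core_elt n mu).

Definition strong_cover (n : nat) (mu ga : seq nat) : Prop :=
  [/\ is_core n mu, is_core n ga, subpart mu ga &
      core_deg n ga = core_deg n mu + 1].

(* R(n-1, la); head 0 la is the length of the bottom row. *)
Definition strip_top (n : nat) (la : seq nat) : seq nat :=
  (head 0 la + (n - 1)) :: la.

(* The length m = n - 1 + deg la - deg nu is an integer which must be
   nonnegative, hence the subtraction-free form. *)
Definition horizontal_strong_strip (n : nat) (la nu : seq nat) : Prop :=
  subpart la nu /\
  exists (m : nat) (c : nat -> seq nat),
    [/\ m + core_deg n nu = n - 1 + core_deg n la,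
        c 0 = nu,
        c m = strip_top n la &
        forall i, i < m -> strong_cover n (c i) (c i.+1) /\
                           head 0 (c i) < head 0 (c i.+1)].

(* Main.v *)
Require Import Defs.
From mathcomp Require Import all_boot.
From mathcomp Require Import order ssralg ssrnum ssrint intdiv.
From mathcomp Require Import zify.
From mathcomp Require Import boolp classical_sets.

(* A core la is recorded by its code c : Z -> Z, with c (p + n) = c p - 1 and a
   bead of the Maya diagram at p iff 0 <= c p.  The generator s_r exchanges the
   values of c at r and r + 1 (mod n), and r is an ascent of la iff
   c (r + 1) < c r.  Matsumoto's argument shows that two ascending words leading
   from the empty core to la are related by the Coxeter relations, so w_la is
   given by any of them, and the condition on w_nu w_la^-1 says that an ascending
   cyclically decreasing word leads from la to nu.

   Let M be the length of the bottom row of la.  Such a word avoids the residue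
   M - 1, hence can be sorted into letters M + i with i decreasing and i < n - 1;
   the word with all these letters leads from la to R(n-1, la).  Inserting the
   smallest missing letter gives a strong cover with a longer bottom row, whence
   the chain.  Conversely, going down the chain from R(n-1, la), the lifting
   property of containment (peel off the largest letter from both cores) shows
   that each core of the chain is reached by a subword of the word for the next
   one. *)

Set Implicit Arguments.
Unset Strict Implicit.
Unset Printing Implicit Defensive.
Import Order.TTheory GRing.Theory Num.Theory.
Local Open Scope nat_scope.

(** * Partitions and corners *)

Lemma is_part_nth_le la i j : is_part la -> i <= j -> nth 0 la j <= nth 0 la i.
Proof.
case/andP=> la_sorted _ le_ij.
have [lt_j|ge_j] := ltnP j (size la); last by rewrite [nth 0 la j]nth_default.
have geq_trans : transitive geq by move=> x y z /= xy yz; apply: leq_trans yz xy.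
have := sorted_leq_nth geq_trans (fun x => leqnn x) 0 la_sorted.
by move=> /(_ i j); apply; rewrite ?inE //; exact: leq_ltn_trans le_ij lt_j.
Qed.

Lemma is_part_nth_gt0 la i : is_part la -> (0 < nth 0 la i) = (i < size la).
Proof.
case/andP=> _ la0; have [lt_i|ge_i] := ltnP i (size la).
  by rewrite lt0n; apply: contraNneq la0 => <-; exact: mem_nth.
by rewrite nth_default.
Qed.

Lemma is_part_ext la mu : is_part la -> is_part mu ->
  (forall i, nth 0 la i = nth 0 mu i) -> la = mu.
Proof.
move=> pla pmu eq_nth; have lt_size i : (i < size la) = (i < size mu).
  by rewrite -!is_part_nth_gt0 // eq_nth.
apply: (@eq_from_nth _ 0) => [|i _ //].
by apply/eqP; rewrite eqn_leq leqNgt lt_size ltnn leqNgt -lt_size ltnn.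
Qed.

(** In a weakly decreasing list the zeros form a suffix, so filtering them out only truncates the
    list. *)
Lemma nth_filter_nz s i : (forall j, nth 0 s j.+1 <= nth 0 s j) ->
  nth 0 [seq x <- s | x != 0] i = nth 0 s i.
Proof.
elim: s i => [|x s IH] i s_le //=.
have s_le' j : nth 0 s j.+1 <= nth 0 s j by exact: (s_le j.+1).
have [x0|x_neq0] /= := eqVneq x 0; last by case: i => [//|i]; rewrite /= IH.
have s0 j : nth 0 (x :: s) j = 0.
  by elim: j => [//|j IHj]; apply/eqP; rewrite -leqn0 -{2}IHj.
by rewrite IH // s0; exact: (s0 i.+1).
Qed.

Lemma is_part_filter_nz s : (forall j, nth 0 s j.+1 <= nth 0 s j) ->
  is_part [seq x <- s | x != 0].
Proof.
move=> s_le; rewrite /is_part mem_filter /= andbT.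
apply/(sortedP 0) => i _.
by rewrite /= !nth_filter_nz.
Qed.

Section Corners.

Variables (n : nat) (r : 'I_n).
Implicit Types la mu ga : seq nat.

Lemma addable_nil_row la i : size la < i -> addable r la i = false.
Proof.
case: i => // i; rewrite ltnS => le_i.
by rewrite /addable /= !nth_default // ltnW.
Qed.

Lemma has_addableP la :
  reflect (exists i, addable r la i) (has (addable r la) (iota 0 (size la).+1)).
Proof.
apply: (iffP hasP) => [[i _ ?]|[i ai]]; exists i => //.
rewrite mem_iota add0n /=; case: leqP => // /addable_nil_row ai0.
by rewrite ai0 in ai.
Qed.

Lemma nth_mkseq_add la i :
  nth 0 (mkseq (fun i => nth 0 la i + addable r la i) (size la).+1) i =
  nth 0 la i + addable r la i.
Proof.
have [lt_i|lt_i] := ltnP i (size la).+1; first by rewrite nth_mkseq.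
by rewrite !nth_default ?size_mkseq // ?addable_nil_row // ltnW.
Qed.

Lemma nth_mkseq_remove la i :
  nth 0 (mkseq (fun i => nth 0 la i - removable r la i) (size la)) i =
  nth 0 la i - removable r la i.
Proof.
have [lt_i|lt_i] := ltnP i (size la); first by rewrite nth_mkseq.
by rewrite !nth_default ?size_mkseq.
Qed.

Lemma add_mono la j : is_part la ->
  nth 0 la j.+1 + addable r la j.+1 <= nth 0 la j + addable r la j.
Proof.
move=> pla; have := is_part_nth_le pla (leqnSn j).
by rewrite /addable /=; case: (_ && _) / andP => //= [[?]|]; lia.
Qed.

Lemma remove_mono la j : is_part la ->
  nth 0 la j.+1 - removable r la j.+1 <= nth 0 la j - removable r la j.
Proof.
move=> pla; have := is_part_nth_le pla (leqnSn j).
rewrite {2}/removable; have [lt_j _|_|eq_j _] := ltngtP (nth 0 la j.+1) (nth 0 la j).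
- by case: (has_residue _ _ _); case: removable; lia.
- by [].
- by rewrite eq_j /=; lia.
Qed.

Lemma nth_add_corners la i : is_part la ->
  nth 0 (add_corners r la) i = nth 0 la i + addable r la i.
Proof.
move=> pla; rewrite /add_corners nth_filter_nz ?nth_mkseq_add // => j.
by rewrite !nth_mkseq_add; exact: add_mono.
Qed.

Lemma nth_remove_corners la i : is_part la ->
  nth 0 (remove_corners r la) i = nth 0 la i - removable r la i.
Proof.
move=> pla; rewrite /remove_corners nth_filter_nz ?nth_mkseq_remove // => j.
by rewrite !nth_mkseq_remove; exact: remove_mono.
Qed.

Lemma is_part_add_corners la : is_part la -> is_part (add_corners r la).
Proof.
by move=> pla; apply: is_part_filter_nz => j; rewrite !nth_mkseq_add; exact: add_mono.
Qed.

Lemma is_part_remove_corners la : is_part la -> is_part (remove_corners r la).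
Proof.
move=> pla; apply: is_part_filter_nz => j; rewrite !nth_mkseq_remove.
exact: remove_mono.
Qed.

(** Only rows of equal length matter. There the residues agree, and if the row below is strictly
    longer in [la], it is so in [mu] as well. *)
Lemma subpart_add_corners la mu : is_part la -> is_part mu ->
  subpart la mu -> subpart (add_corners r la) (add_corners r mu).
Proof.
move=> pla pmu sub i; rewrite !nth_add_corners //.
have := sub i; have := sub i.-1; rewrite /addable.
have [<-|] := eqVneq (nth 0 la i) (nth 0 mu i); last by do 2!case: (_ && _); lia.
by case: has_residue; rewrite ?andbF // !andbT; case: (i == 0) => //=; lia.
Qed.

(** Again only rows of equal length matter: the row above is at most as long in [la] as in [mu], so
    a corner removable from [mu] is removable from [la]. *)
Lemma subpart_remove_corners la mu : is_part la -> is_part mu ->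
  subpart la mu -> subpart (remove_corners r la) (remove_corners r mu).
Proof.
move=> pla pmu sub i; rewrite !nth_remove_corners //.
have := sub i; have := sub i.+1; rewrite /removable.
have [<-|] := eqVneq (nth 0 la i) (nth 0 mu i); last by do 2!case: (_ && _); lia.
by case: has_residue; rewrite ?andbF // !andbT; lia.
Qed.

Lemma subpart_core_act_up la : is_part la ->
  has (addable r la) (iota 0 (size la).+1) -> subpart la (core_act r la).
Proof.
by move=> pla; rewrite /core_act => -> i; rewrite nth_add_corners // leq_addr.
Qed.

End Corners.

(** * Beads and codes of cores *)

Lemma is_part_behead a la : is_part (a :: la) -> is_part la.
Proof.
rewrite /is_part inE negb_or => /andP[a_la /andP[_ ->]].
by rewrite (path_sorted a_la).
Qed.

Lemma count_part la i j : is_part la ->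
  (i < count (fun part => j < part) la) = (j < nth 0 la i).
Proof.
elim: la i => [|a la IH] i pla /=; first by rewrite nth_nil ltn0.
have la_le k : nth 0 la k <= a by exact: (is_part_nth_le pla (leq0n k.+1)).
have pla' := is_part_behead pla.
have [lt_ja|le_aj] := ltnP j a.
  by case: i => [|i] /=; rewrite ?lt_ja // add1n ltnS IH.
rewrite add0n; case: i => [|i] /=.
  rewrite [RHS]ltnNge le_aj IH //; apply/negbTE; rewrite -leqNgt.
  exact: leq_trans le_aj.
have le_ji k : (j < nth 0 la k) = false.
  by apply/negbTE; rewrite -leqNgt; apply: leq_trans (la_le k) le_aj.
by rewrite IH // !le_ji.
Qed.

Local Open Scope ring_scope.

(* The position of the bead of row i in the Maya diagram of la. *)
Definition edge (la : seq nat) (i : nat) : int := (nth 0%N la i)%:Z - i%:Z.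

Definition bead (la : seq nat) (p : int) : Prop := exists i, p = edge la i.

Lemma edge_lt la i j : is_part la -> (i < j)%N -> edge la j < edge la i.
Proof.
move=> pla lt_ij; have := is_part_nth_le pla (ltnW lt_ij); rewrite /edge; lia.
Qed.

Lemma edge_inj la : is_part la -> injective (edge la).
Proof.
move=> pla i j eq_e; case: (ltngtP i j) => // /(edge_lt pla); rewrite eq_e; lia.
Qed.

(** Read from right to left, the beads are the edges of the rows 0, 1, and so on. By strong
    induction the two lists agree, the next entry being the largest bead not yet matched. *)
Lemma bead_inj la mu : is_part la -> is_part mu ->
  (forall p, bead la p <-> bead mu p) -> la = mu.
Proof.
move=> pla pmu eq_b; apply: is_part_ext => // i.
suff: edge la i = edge mu i by rewrite /edge; lia.
elim/ltn_ind: i => i IH.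
have [j ej] : bead mu (edge la i) by apply/eq_b; exists i.
have [k ek] : bead la (edge mu i) by apply/eq_b; exists i.
have le_ij : (i <= j)%N.
  rewrite leqNgt; apply/negP => lt_ji; have := IH j lt_ji; rewrite -ej.
  by move/(edge_inj pla) => eq_ji; rewrite eq_ji ltnn in lt_ji.
have le_ik : (i <= k)%N.
  rewrite leqNgt; apply/negP => lt_ki; have := IH k lt_ki; rewrite -ek.
  by move/(edge_inj pmu) => eq_ki; rewrite eq_ki ltnn in lt_ki.
have [lt_ij|] := ltnP i j; last first.
  by move=> le_ji; rewrite ej; congr (edge mu _); lia.
have [lt_ik|] := ltnP i k; last first.
  by move=> le_ki; rewrite ek; congr (edge la _); lia.
have := edge_lt pmu lt_ij; have := edge_lt pla lt_ik; lia.
Qed.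

(** Adding a cell to a row moves its bead one position to the right. Only an occupied neighbour
    obstructs this, and it has to be the bead of the row just below, of equal length. *)
Lemma bead_succN la i : is_part la ->
  ((i == 0%N) || (nth 0 la i < nth 0 la i.-1)%N) <-> ~ bead la (edge la i + 1).
Proof.
move=> pla; split=> [corner_i [j ej]|nb].
  have lt_ji : (j < i)%N.
    rewrite ltnNge leq_eqVlt; apply/negP => /orP[/eqP eq_ij|/(edge_lt pla)].
      by move: ej; rewrite eq_ij; lia.
    by rewrite -ej; lia.
  case: i lt_ji ej corner_i => // i; rewrite ltnS /= => le_ji ej lt_i.
  by have := is_part_nth_le pla le_ji; move: ej; rewrite /edge; lia.
case: i nb => [//|i] nb /=; have := is_part_nth_le pla (leqnSn i).
rewrite leq_eqVlt => /orP[/eqP eq_i|//]; case: nb; exists i.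
by rewrite /edge eq_i; lia.
Qed.

Lemma bead_predN la i : is_part la ->
  (nth 0 la i.+1 < nth 0 la i)%N <-> ~ bead la (edge la i - 1).
Proof.
move=> pla; split=> [corner_i [j ej]|nb].
  have lt_ij : (i < j)%N.
    rewrite ltnNge leq_eqVlt; apply/negP => /orP[/eqP eq_ij|/(edge_lt pla)].
      by move: ej; rewrite eq_ij; lia.
    by rewrite -ej; lia.
  by have := is_part_nth_le pla lt_ij; move: ej; rewrite /edge; lia.
have := is_part_nth_le pla (leqnSn i).
rewrite leq_eqVlt => /orP[/eqP eq_i|//]; case: nb; exists i.+1.
by rewrite /edge eq_i; lia.
Qed.

Section Codes.

Variable n : nat.
Hypothesis n_gt1 : (1 < n)%N.
Implicit Types (c : int -> int) (la mu : seq nat) (p q : int).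

Definition periodic c := forall p, c (p + n%:Z) = c p - 1.

(* On the runner of p, the last bead of the core is at p + n * c p. *)
Definition codes la c := periodic c /\ forall p, bead la p <-> 0 <= c p.

Lemma periodicM c p k : periodic c -> c (p + n%:Z * k) = c p - k.
Proof.
move=> pc; elim/int_ind: k => [|k IH|k IH]; first by rewrite mulr0 addr0 subr0.
  have -> : p + n%:Z * k.+1%:Z = p + n%:Z * k%:Z + n%:Z.
    by rewrite intS mulrDr mulr1; lia.
  by rewrite pc IH; lia.
apply: (addIr (-1)); rewrite -pc.
have -> : p + n%:Z * - k.+1%:Z + n%:Z = p + n%:Z * - k%:Z.
  by rewrite intS opprD mulrDr mulrN1; lia.
by rewrite IH; lia.
Qed.

(** This reads [c p] off the beads of [la] as a maximum, whence the uniqueness of codes. *)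
Lemma codes_le la c p k : codes la c -> k <= c p <-> bead la (p + n%:Z * k).
Proof. by case=> pc bc; rewrite bc periodicM // subr_ge0. Qed.

Lemma codes_fun la c c' : codes la c -> codes la c' -> c = c'.
Proof.
move=> lac lac'; apply/funext => p; apply/eqP; rewrite eq_le.
by apply/andP; split; [apply/(codes_le _ _ lac')/(codes_le _ _ lac)
  |apply/(codes_le _ _ lac)/(codes_le _ _ lac')].
Qed.

Lemma codes_inj la mu c : is_part la -> is_part mu ->
  codes la c -> codes mu c -> la = mu.
Proof.
by move=> pla pmu [_ bla] [_ bmu]; apply: bead_inj => // p; rewrite bla bmu.
Qed.

Lemma core_bead_sub la p : is_core n la -> bead la p -> bead la (p - n%:Z).
Proof.
case=> pla hook_la [i ->]; apply: contrapT => nb.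
(* k rows have their bead to the right of the empty position, which lies below
   the column j; the cell of column j in the row of p then has hook length n. *)
have [k [lt_k ge_k]] : exists k, edge la k < edge la i - n%:Z /\
    forall m, (m < k)%N -> edge la i - n%:Z < edge la m.
  have ex_k : exists k, edge la k < edge la i - n%:Z.
    exists (size la + i + n).+1; rewrite {1}/edge nth_default /edge; lia.
  have [k lt_k min_k] := ex_minnP ex_k; exists k; split=> // m lt_mk.
  rewrite lt_neqAle; apply/andP; split; first by apply/eqP => eq_m; apply: nb; exists m.
  by rewrite leNgt; apply/negP => /min_k; lia.
have lt_ik : (i < k)%N.
  rewrite ltnNge leq_eqVlt; apply/negP => /orP[/eqP eq_ki|/(edge_lt pla)].
    by move: lt_k; rewrite eq_ki; lia.
  by lia.
have ge_k1 := ge_k k.-1 ltac:(lia).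
have le_k1 := is_part_nth_le pla (_ : i <= k.-1)%N.
have {le_k1} := le_k1 ltac:(lia) => le_k1.
pose j := absz (edge la i - n%:Z + k%:Z - 1)%R.
have ej : j%:Z = edge la i - n%:Z + k%:Z - 1.
  by move: lt_k; rewrite /j {1}/edge; lia.
have j_gt : (nth 0%N la k <= j)%N by move: lt_k ej; rewrite {1}/edge; lia.
have j_lt : (j < nth 0%N la k.-1)%N by move: ge_k1 ej; rewrite {2}/edge; lia.
have count_j : count (fun part => (j < part)%N) la = k.
  have := count_part k j pla; have := count_part k.-1 j pla; lia.
have /eqP[] := hook_la i j ltac:(lia).
by rewrite /hook /arm /leg count_j; move: ej; rewrite /edge; lia.
Qed.

(** By periodicity there is a bead n positions left of the bead of row i. If the cell (i, j) had
    hook length n, this position would be j + 1 - t with t the height of column j; but the rows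
    below height t have their beads to its right and all others to its left. *)
Lemma codes_core la c : is_part la -> codes la c -> is_core n la.
Proof.
move=> pla [pc bc]; split=> // i j lt_j; apply/eqP => hook_n.
have [k ek] : bead la (edge la i - n%:Z).
  apply/bc; have := pc (edge la i - n%:Z); rewrite subrK.
  by have : 0 <= c (edge la i) by [apply/bc; exists i]; lia.
set t := count (fun part => (j < part)%N) la in hook_n *.
have lt_i : (i < t)%N by rewrite count_part.
have lt_k : (k < t)%N = (j < nth 0%N la k)%N by rewrite /t count_part.
move: hook_n ek; rewrite /hook /arm /leg -/t /edge.
by have [lt_kt|le_tk] := ltnP k t; rewrite ?lt_kt ?(leqNgt t k) ?lt_k in lt_k *; lia.
Qed.

(** On each runner the occupied places are closed under moving left by n, by [core_bead_sub]; they
    are nonempty and bounded above, so a last bead exists and defines [c p]. *)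
Lemma core_codes la : is_core n la -> exists c, codes la c.
Proof.
move=> core_la; have [pla _] := core_la.
have bead_subM p k : bead la p -> bead la (p - n%:Z * k%:Z).
  elim: k => [|k IH] bp; first by rewrite mulr0 subr0.
  have := core_bead_sub core_la (IH bp); congr (bead la _); rewrite intS mulrDr; lia.
have last_bead p : exists k : int, forall j, bead la (p + n%:Z * j) <-> j <= k.
  (* So far to the left that p + n * K is the bead of an empty row. *)
  pose K : int := - (absz p + size la)%:Z.
  have bK : bead la (p + n%:Z * K).
    exists (absz (p + n%:Z * K)%R).
    have := leq_pmull (absz p + size la) (ltnW n_gt1).
    move=> le_n; have eK : n%:Z * K = - (n * (absz p + size la))%N%:Z.
      by rewrite /K mulrN PoszM.
    by rewrite /edge nth_default eK; lia.
  have exN : exists m, `[< ~ bead la (p + n%:Z * (K + m%:Z)) >].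
    (* With this m the position p + n * (K + m) lies beyond the bead of the bottom row. *)
    exists (2 * absz p + size la + (nth 0%N la 0).+1)%N; apply/asboolP => -[i ei].
    have := is_part_nth_le pla (leq0n i).
    set x := (absz p + (nth 0%N la 0).+1)%N.
    have := leq_pmull x (ltnW n_gt1) => le_n.
    move: ei; rewrite /edge (_ : K + _ = x%:Z); last by rewrite /K /x; lia.
    rewrite -PoszM; rewrite /x in le_n *; lia.
  have [m /asboolP nbm min_m] := ex_minnP exN.
  have m_gt0 : (0 < m)%N.
    by rewrite lt0n; apply/eqP => m0; apply: nbm; rewrite m0 addr0.
  have bm : bead la (p + n%:Z * (K + m%:Z - 1)).
    apply: contrapT => nb; have /min_m : `[< ~ bead la (p + n%:Z * (K + m.-1%:Z)) >].
      by apply/asboolP; have -> : K + m.-1%:Z = K + m%:Z - 1 by lia.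
    by lia.
  exists (K + m%:Z - 1) => j; split=> [bj|le_j].
    rewrite leNgt; apply/negP => lt_j; apply: nbm.
    have := bead_subM _ (absz (j - (K + m%:Z))%R) bj; congr (bead la _).
    by rewrite -addrA -mulrBr; congr (_ + _ * _); lia.
  have := bead_subM _ (absz (K + m%:Z - 1 - j)%R) bm; congr (bead la _).
  by rewrite -addrA -mulrBr; congr (_ + _ * _); lia.
have [c last_c] := choice last_bead.
exists c; split=> p; last by rewrite -last_c mulr0 addr0.
apply/eqP; rewrite eq_le; apply/andP; split.
  rewrite lerBrDr; apply/last_c.
  have -> : p + n%:Z * (c (p + n%:Z) + 1) = p + n%:Z + n%:Z * c (p + n%:Z).
    by rewrite mulrDr mulr1; lia.
  exact/last_c.
apply/last_c; have -> : p + n%:Z + n%:Z * (c p - 1) = p + n%:Z * c p.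
  by rewrite mulrBr mulr1; lia.
exact/last_c.
Qed.

Definition code la : int -> int := xget (fun=> 0) [set c | codes la c]%classic.

Lemma codeP la : is_core n la -> codes la (code la).
Proof.
case/core_codes => c lac; rewrite /code.
by case: xgetP => [_ -> //|/(_ c)].
Qed.

Lemma codeE la c : is_core n la -> codes la c -> code la = c.
Proof. by move=> /codeP; exact: codes_fun. Qed.

Lemma code_inj la mu : is_core n la -> is_core n mu -> code la = code mu -> la = mu.
Proof.
move=> cla cmu eq_c; have [pla _] := cla; have [pmu _] := cmu.
by apply: (codes_inj pla pmu (codeP cla)); rewrite eq_c; exact: codeP.
Qed.

(** * The action of a generator on codes *)

Definition act (r : int) c : int -> int := fun p =>
  if (n%:Z %| p - r)%Z then c (p + 1)
  else if (n%:Z %| p - r - 1)%Z then c (p - 1) else c p.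

Lemma dvd_pred p : (n%:Z %| p)%Z -> (n%:Z %| p - 1)%Z = false.
Proof.
move=> dp; apply/negbTE; apply/negP => /(rpredB dp).
rewrite opprB addrCA subrr addr0 dvdz1 absz_nat => /eqP n1.
by move: n_gt1; rewrite n1.
Qed.

Lemma dvd_pred' p : (n%:Z %| p - 1)%Z -> (n%:Z %| p)%Z = false.
Proof. by move=> dp; apply/negbTE; apply/negP => /dvd_pred; rewrite dp. Qed.

Lemma dvd_congr p q : (n%:Z %| p - q)%Z -> (n%:Z %| p)%Z = (n%:Z %| q)%Z.
Proof.
move=> dpq; apply/idP/idP => [dp|dq].
  have -> : q = p - (p - q) by lia.
  exact: rpredB.
by rewrite -(subrK q p); exact: rpredD.
Qed.

Lemma periodic_act r c : periodic c -> periodic (act r c).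
Proof.
move=> pc p; rewrite /act.
rewrite (@dvd_congr (p + n%:Z - r) (p - r)); last first.
  by rewrite (_ : _ - _ = n%:Z) //; lia.
rewrite (@dvd_congr (p + n%:Z - r - 1) (p - r - 1)); last first.
  by rewrite (_ : _ - (_ - _ - _) = n%:Z) //; lia.
have -> : p + n%:Z + 1 = p + 1 + n%:Z by lia.
have -> : p + n%:Z - 1 = p - 1 + n%:Z by lia.
by rewrite (pc (p + 1)) (pc (p - 1)) pc; case: ifP => // _; case: ifP.
Qed.

(** The same constant [k] serves for every [x], so comparisons between values near [p] transfer to
    [q]. *)
Lemma periodic_res c p q : periodic c -> (n%:Z %| p - q)%Z ->
  exists k, forall x, c (p + x) = c (q + x) - k.
Proof.
move=> pc /dvdzP[k ek]; exists k => x; rewrite -periodicM //.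
by congr c; rewrite mulrC -ek; lia.
Qed.

Lemma has_residueE (r : 'I_n) i j :
  has_residue r i j = (n%:Z %| j%:Z - i%:Z - (r : nat)%:Z)%Z.
Proof.
rewrite /has_residue -addrA -opprD -[(_ %| _)%Z]eqz_mod_dvd.
by rewrite -PoszD !modz_nat eqz_nat.
Qed.

Section Act.

Variables (r : 'I_n) (la : seq nat) (c : int -> int).
Hypotheses (pla : is_part la) (lac : codes la c).
Let rz : int := (r : nat)%:Z.

Lemma code_edge i : 0 <= c (edge la i).
Proof. by case: lac => _ bc; apply/bc; exists i. Qed.

Lemma code_lt0 p : (c p < 0) <-> ~ bead la p.
Proof. by case: lac => _ bc; rewrite bc ltNge; split=> /negP. Qed.

Lemma addableE i : addable r la i =
  (n%:Z %| edge la i - rz)%Z && (c (edge la i + 1) < 0).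
Proof.
rewrite /addable has_residueE andbC; congr (_ && _).
by apply/idP/idP => [/(bead_succN _ pla)/code_lt0|/code_lt0/(bead_succN _ pla)].
Qed.

Lemma removableE i : removable r la i =
  (n%:Z %| edge la i - rz - 1)%Z && (c (edge la i - 1) < 0).
Proof.
rewrite /removable andbC.
have -> : (nth 0 la i.+1 < nth 0 la i)%N = (c (edge la i - 1) < 0).
  by apply/idP/idP => [/(bead_predN _ pla)/code_lt0|/code_lt0/(bead_predN _ pla)].
have [/code_lt0/(bead_predN _ pla) lt_i|] := boolP (c _ < 0); last by rewrite !andbF.
rewrite !andbT has_residueE; congr (_ %| _)%Z; rewrite /edge /rz; lia.
Qed.

Lemma code_succ_ltr p : (n%:Z %| p - rz)%Z -> (c (p + 1) < c p) = (c (rz + 1) < c rz).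
Proof.
case: lac => pc _ /(periodic_res pc)[k ek].
by have := ek 1; have := ek 0; rewrite !addr0 => -> ->; lia.
Qed.

Lemma code_succ_ltl p : (n%:Z %| p - rz)%Z -> (c p < c (p + 1)) = (c rz < c (rz + 1)).
Proof.
case: lac => pc _ /(periodic_res pc)[k ek].
by have := ek 1; have := ek 0; rewrite !addr0 => -> ->; lia.
Qed.

Lemma has_addableE :
  has (addable r la) (iota 0 (size la).+1) = (c (rz + 1) < c rz).
Proof.
apply/(has_addableP r la)/idP => [[i]|lt_c].
  rewrite addableE => /andP[dvd_i lt0].
  by rewrite -(code_succ_ltr dvd_i); apply: lt_le_trans lt0 (code_edge i).
case: lac => pc bc.
(* The row to extend is that of the last bead on the runner of [r]: its right neighbour lies beyond
   the last bead of the next runner. *)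
have [i ei] : bead la (rz + n%:Z * c rz) by apply/(codes_le _ _ lac).
exists i; rewrite addableE -ei addrAC subrr add0r dvdz_mulr //=.
by rewrite addrAC periodicM // subr_lt0.
Qed.

Lemma has_removableE : (exists i, removable r la i) <-> (c rz < c (rz + 1)).
Proof.
split=> [[i]|lt_c].
  rewrite removableE => /andP[dvd_i lt0].
  have := code_succ_ltl (p := edge la i - 1).
  rewrite addrAC dvd_i subrK => <- //.
  by apply: lt_le_trans lt0 (code_edge i).
case: lac => pc bc.
have [i ei] : bead la (rz + 1 + n%:Z * c (rz + 1)) by apply/(codes_le _ _ lac).
exists i; rewrite removableE -ei.
have -> : rz + 1 + n%:Z * c (rz + 1) - 1 = rz + n%:Z * c (rz + 1) by lia.
have -> : rz + 1 + n%:Z * c (rz + 1) - rz - 1 = n%:Z * c (rz + 1) by lia.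
by rewrite dvdz_mulr //= periodicM // subr_lt0.
Qed.

(** Every bead is followed. At an ascent each bead on the runner of r + 1 has a bead to its left, so
    moving the unobstructed beads of the runner of r to the right exchanges the two runners. The
    other case is the mirror image, and no bead moves when the two code values agree. *)
Lemma codes_core_act : codes (core_act r la) (act rz c).
Proof.
have [pc bc] := lac; split; first exact: periodic_act.
move=> p; rewrite /core_act has_addableE /act; case: ifP => asc.
  have edgeE i : edge (add_corners r la) i = edge la i + (addable r la i)%:Z.
    by rewrite /edge nth_add_corners //; lia.
  split=> [[i ->]|].
    rewrite edgeE addableE.
    have bi := code_edge i; have [d|nd] /= := boolP (n%:Z %| edge la i - rz)%Z.
      have [lt0|ge0] /= := ltP (c (edge la i + 1)) 0.
        have -> : edge la i + 1 - rz - 1 = edge la i - rz by lia.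
        by rewrite d addrAC dvd_pred' ?addrK // addrK.
      by rewrite addr0 d.
    rewrite addr0 (negbTE nd); case: ifP => // d.
    have := code_succ_ltr (p := edge la i - 1); rewrite addrAC d asc subrK.
    by move=> /(_ isT); lia.
  have [d|nd] := boolP (_ %| _)%Z.
    move=> ge0; have := code_succ_ltr d; rewrite asc => lt_p.
    have [i ei] : bead la p by apply/bc; lia.
    by exists i; rewrite edgeE addableE -ei ltNge ge0 andbF addr0.
  have [d|nd'] := boolP (_ %| _)%Z; last first.
    by move/bc => [i ei]; exists i; rewrite edgeE addableE -ei (negbTE nd) addr0.
  move/bc=> [i ei]; have [lt0|/bc[j ej]] := ltP (c p) 0.
    exists i; rewrite addrAC in d; rewrite edgeE addableE -ei subrK lt0 d /=; lia.
  by exists j; rewrite edgeE addableE -ej (negbTE nd) addr0.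
have edgeE i : edge (remove_corners r la) i = edge la i - (removable r la i)%:Z.
  rewrite /edge nth_remove_corners //.
  have : removable r la i -> (0 < nth 0 la i)%N.
    by case/andP => lt_i _; apply: leq_ltn_trans lt_i.
  by case: removable => [/(_ isT)|_]; lia.
move/negbT: asc; rewrite -leNgt => desc.
have desc' q : (n%:Z %| q - rz)%Z -> c q <= c (q + 1).
  by move/code_succ_ltr; rewrite leNgt => ->; rewrite -leNgt.
split=> [[i ->]|].
  rewrite edgeE removableE.
  have bi := code_edge i; have [d|nd] /= := boolP (n%:Z %| edge la i - rz - 1)%Z.
    have [lt0|ge0] /= := ltP (c (edge la i - 1)) 0.
      by rewrite addrAC d subrK.
    by rewrite !subr0 (dvd_pred' d) d.
  rewrite !subr0 (negbTE nd); case: ifP => // d.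
  exact: le_trans (desc' _ d).
have [d|nd] := boolP (_ %| _)%Z.
  move/bc => [i ei]; have [lt0|/bc[j ej]] := ltP (c p) 0; last first.
    by exists j; rewrite edgeE removableE -ej dvd_pred // subr0.
  exists i; rewrite edgeE removableE -ei addrK.
  have -> : p + 1 - rz - 1 = p - rz by lia.
  by rewrite d lt0 /=; lia.
have [d|nd'] := boolP (_ %| _)%Z; last first.
  by move/bc => [i ei]; exists i; rewrite edgeE removableE -ei (negbTE nd') subr0.
move=> ge0; have := desc' (p - 1); rewrite addrAC d subrK => /(_ isT) le_p.
have [i ei] : bead la p by apply/bc; apply: le_trans le_p.
by exists i; rewrite edgeE removableE -ei d /= ltNge ge0 subr0.
Qed.

End Act.

Lemma is_part_core_act (r : 'I_n) la : is_part la -> is_part (core_act r la).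
Proof.
move=> pla; rewrite /core_act; case: ifP => _.
  exact: is_part_add_corners.
exact: is_part_remove_corners.
Qed.

Lemma is_core_act (r : 'I_n) la : is_core n la -> is_core n (core_act r la).
Proof.
move=> cla; have [pla _] := cla.
exact: codes_core (is_part_core_act r pla) (codes_core_act r pla (codeP cla)).
Qed.

Lemma code_act (r : 'I_n) la : is_core n la ->
  code (core_act r la) = act (r : nat)%:Z (code la).
Proof.
move=> cla; have [pla _] := cla; apply: codeE; first exact: is_core_act.
exact: codes_core_act (codeP cla).
Qed.

(* On the 2n - 2 positions around r, act r is the transposition of r and r + 1,
   without any congruence. *)
Lemma act_near r c p : r + 1 - n%:Z < p -> p < r + n%:Z ->
  act r c p = if p == r then c (r + 1) else if p == r + 1 then c r else c p.
Proof.
move=> lo hi; rewrite /act.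
have [->|ne_pr] := eqVneq p r; first by rewrite subrr dvdz0.
have small x : x != 0 -> (`|x| < n)%N -> (n%:Z %| x)%Z = false.
  move=> x0 ltx; apply/negbTE; apply/negP; rewrite /dvdz absz_nat => /dvdn_leq.
  by lia.
have -> : (n%:Z %| p - r)%Z = false by apply: small; lia.
have [->|ne_pr1] := eqVneq p (r + 1).
  have -> : r + 1 - r - 1 = 0 by lia.
  by rewrite dvdz0 addrK.
by rewrite small //; lia.
Qed.

Lemma periodic_window c c' x : periodic c -> periodic c' ->
  (forall p, x <= p -> p < x + n%:Z -> c p = c' p) -> c = c'.
Proof.
move=> pc pc' eq_win; apply/funext => p.
have n0 : n%:Z != 0 by lia.
have [k [y [-> lo hi]]] : exists k y, [/\ p = y + n%:Z * k, x <= y & y < x + n%:Z].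
  have := divz_eq (p - x) n%:Z; have := modz_ge0 (p - x) n0.
  have := ltz_mod (p - x) n0.
  move: ((p - x) %/ n%:Z)%Z ((p - x) %% n%:Z)%Z => k y hi lo eq_p.
  exists k, (x + y); split; last by rewrite ltrD2l.
    by rewrite -[LHS](subrK x) eq_p mulrC addrC [_ * _ + y]addrC addrA.
  by rewrite lerDl.
by rewrite !periodicM // eq_win.
Qed.

Lemma periodic_act_res r r' c : periodic c -> (n%:Z %| r - r')%Z ->
  act r c = act r' c.
Proof.
move=> pc drr; apply/funext => p; rewrite /act.
rewrite (@dvd_congr (p - r) (p - r')); last first.
  by rewrite (_ : _ - _ = - (r - r')) ?rpredN //; lia.
rewrite (@dvd_congr (p - r - 1) (p - r' - 1)) //.
by rewrite (_ : _ - (_ - _ - _) = - (r - r')) ?rpredN //; lia.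
Qed.

End Codes.

(** * The height of a core *)

(* gap (c i) (c j) is the number of inversions of an affine permutation between
   the residues i < j, if c codes the core of its coset. *)
Definition gap (a b : int) : nat := (absz (a - b)%R - (b < a)%R)%N.

Fixpoint inv (s : seq int) : nat :=
  if s is a :: s' then (\sum_(b <- s') gap a b + inv s')%N else 0%N.

(** When a window of length n slides right by one, its first value [b] leaves and returns at the
    other end as [b - 1]; each pair involving it keeps its contribution. *)
Lemma gap_shift a b : gap a (b - 1) = gap b a.
Proof. by rewrite /gap; case: ltP => ?; case: ltP => ? /=; lia. Qed.

Lemma gap_swap a b : b < a -> gap b a = (gap a b).+1.
Proof. by rewrite /gap => lt_ba; rewrite lt_ba ltNge (ltW lt_ba) /=; lia. Qed.

Lemma inv_rcons s b : inv (rcons s b) = (inv s + \sum_(a <- s) gap a b)%N.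
Proof.
elim: s => [|a s IH] /=; first by rewrite !big_nil.
by rewrite -cats1 big_cat big_seq1 cats1 IH big_cons addnACA.
Qed.

Lemma inv_swap a b s : b < a -> inv [:: b, a & s] = (inv [:: a, b & s]).+1.
Proof.
move=> lt_ba /=; rewrite !big_cons (gap_swap lt_ba) !addSn -!addnA.
by congr (_ + _).+1; exact: addnCA.
Qed.

Definition window (c : int -> int) (x : int) (m : nat) : seq int :=
  [seq c (x + i%:Z) | i <- iota 0 m].

Lemma window_cons c x m : window c x m.+1 = c x :: window c (x + 1) m.
Proof.
rewrite /window /= addr0 -addn1 addnC iotaDl -map_comp; congr (_ :: _).
by apply: eq_map => i /=; congr c; lia.
Qed.

Lemma window_rcons c x m : window c x m.+1 = rcons (window c x m) (c (x + m%:Z)).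
Proof. by rewrite /window -addn1 iotaD map_cat cats1 add0n. Qed.

Section Height.

Variable n : nat.
Hypothesis n_gt1 : (1 < n)%N.
Implicit Types (c : int -> int) (la : seq nat).

Lemma inv_window_succ c x : periodic n c ->
  inv (window c (x + 1) n) = inv (window c x n).
Proof.
move=> pc; have -> : n = n.-1.+1 by lia.
rewrite window_rcons window_cons inv_rcons /= addnC; congr (_ + _)%N.
have -> : x + 1 + n.-1%:Z = x + n%:Z by lia.
by rewrite pc; apply: eq_bigr => b _; exact: gap_shift.
Qed.

Lemma inv_window c x : periodic n c -> inv (window c x n) = inv (window c 0 n).
Proof.
move=> pc; elim/int_ind: x => // k IH; first by rewrite intS addrC inv_window_succ.
by rewrite -(inv_window_succ _ pc) -{}IH; congr (inv (window c _ n)); lia.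
Qed.

(** Up to the additive constant [ht n [::]] this is the degree of the core, computed from its code
    without reference to words; see [ht_core_deg]. *)
Definition ht la : nat := inv (window (code n la) 0 n).

Lemma act_at (r : int) c : act n r c r = c (r + 1).
Proof. by rewrite act_near ?eqxx //; lia. Qed.

Lemma act_at1 (r : int) c : act n r c (r + 1) = c r.
Proof.
rewrite act_near ?eqxx //; [|lia..].
by have -> : (r + 1 == r) = false by lia.
Qed.

Lemma act_off (r x : int) c : r + 1 - n%:Z < x -> x < r + n%:Z ->
  x != r -> x != r + 1 -> act n r c x = c x.
Proof. by move=> lo hi /negbTE xr /negbTE xr1; rewrite act_near // xr xr1. Qed.

Lemma inv_act (r : int) c : periodic n c -> c (r + 1) < c r ->
  inv (window (act n r c) 0 n) = (inv (window c 0 n)).+1.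
Proof.
move=> pc lt_c.
(* Sliding the window to start at [r] makes the exchange one of its first two entries. *)
rewrite -(inv_window r pc) -(inv_window r (periodic_act n_gt1 r pc)).
have -> : n = n.-2.+2 by lia.
rewrite !window_cons -inv_swap //.
have n2 : n.-2.+2 = n by lia.
rewrite n2 !act_near; [|lia..].
rewrite eqxx; have -> : (r + 1 == r) = false by lia.
rewrite eqxx; congr (inv [:: _, _ & _]); apply/eq_in_map => i.
rewrite mem_iota => lt_i; rewrite act_near; [|lia..].
have -> : (r + 1 + 1 + i%:Z == r) = false by lia.
by have -> : (r + 1 + 1 + i%:Z == r + 1) = false by lia.
Qed.

Lemma actK (r : int) c : periodic n c -> act n r (act n r c) = c.
Proof.
move=> pc; have pc' := periodic_act n_gt1 r pc.
apply: (periodic_window n_gt1 (x := r)) => // [|p lo hi].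
  exact: periodic_act.
rewrite !act_near //; [|lia..].
rewrite !eqxx; have -> : (r + 1 == r) = false by lia.
by case: eqVneq => [->|_] //; case: eqVneq => [->|_].
Qed.

Definition asc (r : 'I_n) la := has (addable r la) (iota 0 (size la).+1).

Section Step.

Variables (r : 'I_n) (la : seq nat).
Hypothesis cla : is_core n la.
Let pla : is_part la := proj1 cla.
Let c := code n la.
Let rz : int := (r : nat)%:Z.

Lemma periodic_code : periodic n c.
Proof. by case: (codeP n_gt1 cla). Qed.

Lemma ascE : asc r la = (c (rz + 1) < c rz).
Proof. by rewrite /asc (has_addableE n_gt1 r pla (codeP n_gt1 cla)). Qed.

Lemma core_act_asc : asc r la -> core_act r la = add_corners r la.
Proof. by rewrite /asc /core_act => ->. Qed.

Lemma core_actK : core_act r (core_act r la) = la.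
Proof.
have cla' := is_core_act n_gt1 r cla.
apply: (code_inj n_gt1 (is_core_act n_gt1 r cla') cla).
by rewrite !code_act // actK //; exact: periodic_code.
Qed.

Lemma asc_core_act : asc r (core_act r la) = (c rz < c (rz + 1)).
Proof.
rewrite /asc (has_addableE n_gt1 r (is_part_core_act r pla)
  (codes_core_act n_gt1 r pla (codeP n_gt1 cla))).
by rewrite act_at act_at1.
Qed.

Lemma ht_asc : asc r la -> ht (core_act r la) = (ht la).+1.
Proof.
by rewrite ascE /ht code_act // => lt_c; apply: inv_act => //; exact: periodic_code.
Qed.

Lemma core_act_fix : c (rz + 1) = c rz -> core_act r la = la.
Proof.
move=> eq_c; apply: (code_inj n_gt1 (is_core_act n_gt1 r cla) cla).
rewrite code_act //; apply: (periodic_window n_gt1 (x := rz)).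
- exact (periodic_act n_gt1 rz periodic_code).
- exact periodic_code.
move=> p lo hi; rewrite act_near; [|lia..].
by case: eqVneq => [->|_] //; case: eqVneq => [->|_].
Qed.

End Step.

Lemma ht_desc r la : is_core n la -> asc r (core_act r la) ->
  ht la = (ht (core_act r la)).+1.
Proof.
by move=> cla a; rewrite -(ht_asc (is_core_act n_gt1 r cla) a) core_actK.
Qed.

Lemma step_cases r la : is_core n la ->
  [\/ asc r la, asc r (core_act r la) | core_act r la = la].
Proof.
move=> cla; rewrite asc_core_act // ascE //.
set x := code n la _; set y := code n la _.
case: (ltgtP x y) => [lt|gt|eq]; [exact: Or31|exact: Or32|].
by apply: Or33; exact: core_act_fix.
Qed.

Lemma ht_core_act r la : is_core n la ->
  (ht (core_act r la) <= (ht la).+1 ?= iff asc r la)%N.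
Proof.
move=> cla; have [a|a|fix_la] := step_cases r cla.
- by rewrite ht_asc //; split; rewrite ?a // eqxx.
- have := ht_desc cla a => ->; split; first by lia.
  have -> : asc r la = false by rewrite ascE // ltNge ltW // -asc_core_act.
  by lia.
rewrite fix_la; split; first by lia.
suff -> : asc r la = false by lia.
by apply/negP => a; have := ht_asc cla a; rewrite fix_la; lia.
Qed.

(* [asc r (core_act r la)] says that r is a descent of la. *)
Lemma desc_removable r la : is_core n la ->
  asc r (core_act r la) <-> exists i, removable r la i.
Proof.
move=> cla; rewrite asc_core_act //.
have [pla _] := cla.
by rewrite (has_removableE n_gt1 r pla (codeP n_gt1 cla)).
Qed.

Lemma core_act_desc r la : is_core n la -> asc r (core_act r la) ->
  core_act r la = remove_corners r la.
Proof.
move=> cla a; rewrite /core_act -/(asc r la).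
by rewrite ascE // ltNge ltW // -asc_core_act.
Qed.

Lemma desc_not_asc r la : is_core n la -> asc r (core_act r la) -> asc r la = false.
Proof. by move=> cla a; rewrite ascE // ltNge ltW // -asc_core_act. Qed.

Lemma add_corners_id r la : is_part la -> asc r la = false -> add_corners r la = la.
Proof.
move=> pla na; apply: is_part_ext => //; first exact: is_part_add_corners.
move=> i; rewrite nth_add_corners //; case add_i: (addable r la i); last exact: addn0.
suff : asc r la by rewrite na.
by apply/has_addableP; exists i.
Qed.

Lemma remove_corners_id r la : is_core n la -> asc r (core_act r la) = false ->
  remove_corners r la = la.
Proof.
move=> cla na; have [pla _] := cla.
apply: is_part_ext => //; first exact: is_part_remove_corners.
move=> i; rewrite nth_remove_corners //; case rem: removable; last exact: subn0.
have /desc_removable : exists i, removable r la i by exists i.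
by rewrite na => /(_ cla).
Qed.

Lemma residue_ex (p : int) : exists r : 'I_n, (n%:Z %| p - (r : nat)%:Z)%Z.
Proof.
have n0 : n%:Z != 0 by lia.
have ge0 := modz_ge0 p n0; have lt_n : (absz (p %% n)%Z < n)%N.
  by have := ltz_mod p n0; move: (p %% n)%Z ge0 => x; lia.
exists (Ordinal lt_n); rewrite /= gez0_abs // {1}(divz_eq p n) addrK.
exact: dvdz_mull.
Qed.

Lemma desc_ex la : is_core n la -> la <> [::] -> exists r : 'I_n, asc r (core_act r la).
Proof.
move=> cla la_neq0; have [pla _] := cla.
have s_gt0 : (0 < size la)%N by case: (la) la_neq0.
(* The last cell of the last nonempty row is always a removable corner; [r] is its residue. *)
pose i := (size la).-1; have [r dr] := residue_ex (edge la i - 1).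
exists r; apply/(desc_removable r cla); exists i.
rewrite (removableE n_gt1 r pla (codeP n_gt1 cla)) addrAC dr /=.
apply/(code_lt0 (codeP n_gt1 cla))/(bead_predN i pla).
by rewrite [X in (X < _)%N]nth_default ?is_part_nth_gt0 // /i prednK.
Qed.

End Height.

(** * Words acting on cores *)

Section CoxeterAction.

Variable n : nat.
Hypothesis n_gt1 : (1 < n)%N.
Implicit Types (c : int -> int) (la : seq nat) (u v w p : seq 'I_n).

(** Both sides exchange the values at r and r + 2 and fix all others in the window from r, which
    contains r + 2 because n > 2. *)
Lemma act_braid (r : int) c : periodic n c -> (2 < n)%N ->
  act n r (act n (r + 1) (act n r c)) = act n (r + 1) (act n r (act n (r + 1) c)).
Proof.
move=> pc n_gt2; have pact r' c' := @periodic_act n n_gt1 r' c'.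
apply: (periodic_window n_gt1 (x := r)); first by do 3!apply/pact.
  by do 3!apply/pact.
move=> x lo hi.
have [->|xr] := eqVneq x r.
  rewrite !act_at // (act_off n_gt1 (r := r) (x := r + 1 + 1)); [|lia..].
  by rewrite (act_off n_gt1 (r := r + 1) (x := r)) ?act_at //; lia.
have [->|xr1] := eqVneq x (r + 1).
  rewrite act_at1 // act_at // (act_off n_gt1 (r := r + 1) (x := r)); [|lia..].
  by rewrite (act_off n_gt1 (r := r) (x := r + 1 + 1)) ?act_at ?act_at1 //; lia.
have [->|xr2] := eqVneq x (r + 1 + 1).
  rewrite (act_off n_gt1 (r := r) (x := r + 1 + 1)); [|lia..].
  by rewrite !act_at1 // (act_off n_gt1 (r := r + 1) (x := r)) ?act_at //; lia.
by rewrite !act_off //; lia.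
Qed.

Lemma act_comm (i j : int) c : periodic n c -> i + 1 < j -> j + 1 < i + n%:Z ->
  act n i (act n j c) = act n j (act n i c).
Proof.
move=> pc lt_ij lt_ji; have pact r' c' := @periodic_act n n_gt1 r' c'.
apply: (periodic_window n_gt1 (x := i)); first by do 2!apply/pact.
  by do 2!apply/pact.
move=> x lo hi.
have [->|xi] := eqVneq x i.
  by rewrite act_at // !(act_off n_gt1 (r := j)) ?act_at //; lia.
have [->|xi1] := eqVneq x (i + 1).
  by rewrite act_at1 // !(act_off n_gt1 (r := j)) ?act_at1 //; lia.
have [->|xj] := eqVneq x j.
  by rewrite act_at // !(act_off n_gt1 (r := i)) ?act_at //; lia.
have [->|xj1] := eqVneq x (j + 1).
  by rewrite act_at1 // !(act_off n_gt1 (r := i)) ?act_at1 //; lia.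
by rewrite !act_off //; lia.
Qed.

Lemma dvd_ordS (i : 'I_n) : (n%:Z %| (ordS i : nat)%:Z - ((i : nat)%:Z + 1))%Z.
Proof.
rewrite -[(_ %| _)%Z]eqz_mod_dvd /= -modz_nat modz_mod -addn1 PoszD.
by rewrite eqxx.
Qed.

(** Replacing the residue [ordS i] by the integer i + 1 avoids the wrap-around at n - 1 in
    computations with codes. *)
Lemma act_ordS (i : 'I_n) c : periodic n c ->
  act n (ordS i : nat)%:Z c = act n ((i : nat)%:Z + 1) c.
Proof. by move=> pc; apply: periodic_act_res => //; exact: dvd_ordS. Qed.

Lemma core_act_braid (i : 'I_n) la : is_core n la -> (2 < n)%N ->
  core_act i (core_act (ordS i) (core_act i la)) =
  core_act (ordS i) (core_act i (core_act (ordS i) la)).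
Proof.
move=> cla n_gt2; have cact := is_core_act n_gt1.
apply: (code_inj n_gt1); [by do 3!apply/cact|by do 3!apply/cact|].
rewrite !code_act //; do ?apply/cact => //.
have pc := periodic_code n_gt1 cla; have pact r' c' := @periodic_act n n_gt1 r' c'.
by rewrite !act_ordS; [exact: act_braid| |do 2!apply/pact| |exact/pact].
Qed.

Lemma core_act_comm (i j : 'I_n) la : is_core n la -> j != ordS i -> i != ordS j ->
  core_act i (core_act j la) = core_act j (core_act i la).
Proof.
move=> cla; wlog lt_ij : i j / (i < j)%N => [IH|].
  case: (ltngtP i j) => [lt|gt|/val_inj-> //] ji ij; first exact: IH.
  by rewrite (IH j i).
move=> ji ij; have cact := is_core_act n_gt1.
apply: (code_inj n_gt1); [by do 2!apply/cact|by do 2!apply/cact|].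
rewrite !code_act //; do ?apply/cact => //.
apply: act_comm; first exact: periodic_code.
  have [lt_i1|] := ltnP i.+1 j; first lia.
  move=> le_j; case/eqP: ji; apply: val_inj => /=.
  by rewrite modn_small; have := ltn_ord j; lia.
(* The remaining possibility is j = n - 1 and i = 0, where [i] is [ordS j]. *)
have := ltn_ord j; have [lt_j1|le_j1] := ltnP j.+1 (i + n); first lia.
move=> lt_j; case/eqP: ij; apply: val_inj => /=.
have -> : j.+1 = n by lia.
by rewrite modnn; lia.
Qed.

Lemma is_core_word u la : is_core n la -> is_core n (core_act_word u la).
Proof. by move=> cla; elim: u => //= r u; exact: is_core_act. Qed.

Lemma core_act_cat u v la :
  core_act_word (u ++ v) la = core_act_word u (core_act_word v la).
Proof. exact: foldr_cat. Qed.

Lemma core_act_equiv u v : cox_equiv u v ->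
  forall la, is_core n la -> core_act_word u la = core_act_word v la.
Proof.
elim=> {u v} [u|u v _ IH|u v w _ IHu _ IHv|u u' v v' _ IHu _ IHv|i|i n_gt2|i j ji ij] la cla //.
- by rewrite IH.
- by rewrite IHu // IHv.
- by rewrite !core_act_cat IHv // IHu //; exact: is_core_word.
- exact: core_actK.
- exact: core_act_braid.
- exact: core_act_comm.
Qed.

Fixpoint asc_word u la :=
  if u is r :: u' then asc_word u' la && asc r (core_act_word u' la) else true.

Lemma asc_word_cat u v la :
  asc_word (u ++ v) la = asc_word v la && asc_word u (core_act_word v la).
Proof.
elim: u => [|r u IH] /=; first by rewrite andbT.
by rewrite IH core_act_cat andbA.
Qed.

Lemma ht_word u la : is_core n la ->
  (ht n (core_act_word u la) <= ht n la + size u ?= iff asc_word u la)%N.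
Proof.
move=> cla; elim: u => [|r u [IH IHe]] /=; first by rewrite addn0; split; rewrite ?eqxx.
have [lew lee] := ht_core_act n_gt1 r (is_core_word u cla).
split; first lia.
rewrite -lee -IHe; apply/eqP/andP => [eq_ht|[/eqP eq_u /eqP eq_r]]; last by lia.
by split; apply/eqP; lia.
Qed.

(** Whether a word ascends from [la] thus depends only on its size and on the core it reaches, so
    words of equal size with the same target are interchangeable. *)
Lemma asc_wordP u la : is_core n la ->
  reflect (ht n (core_act_word u la) = (ht n la + size u)%N) (asc_word u la).
Proof. by move=> cla; rewrite -(ht_word u cla).2; exact: eqP. Qed.

Lemma asc_word_ex la : is_core n la ->
  exists u, asc_word u [::] /\ core_act_word u [::] = la.
Proof.
have [k] := ubnP (ht n la); elim: k => // k IH in la *; rewrite ltnS => le_k cla.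
have [->|la_neq0] := EM (la = [::]); first by exists [::].
have [r desc_r] := desc_ex n_gt1 cla la_neq0.
have eq_ht := ht_desc n_gt1 cla desc_r.
have [||u [asc_u u_la]] := IH (core_act r la); first lia.
  exact: is_core_act.
exists (r :: u); rewrite /= asc_u u_la desc_r; split=> //; exact: core_actK.
Qed.

Lemma core_nil : is_core n [::].
Proof. by split=> // i j; rewrite nth_nil. Qed.

End CoxeterAction.

(** * Matsumoto's argument and the element of a core *)

Section Words.

Variable n : nat.
Hypothesis n_gt1 : (1 < n)%N.
Implicit Types (la : seq nat) (u v w p q : seq 'I_n) (r s t : 'I_n).

Lemma cox_catl u v v' : cox_equiv v v' -> cox_equiv (u ++ v) (u ++ v').
Proof. by move=> ?; apply: cox_cat => //; exact: cox_refl. Qed.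

Lemma cox_catr u u' v : cox_equiv u u' -> cox_equiv (u ++ v) (u' ++ v).
Proof. by move=> ?; apply: cox_cat => //; exact: cox_refl. Qed.

Lemma cox_cons r u v : cox_equiv u v -> cox_equiv (r :: u) (r :: v).
Proof. exact: (@cox_catl [:: r]). Qed.

Lemma cox_sq_cons r u : cox_equiv (r :: r :: u) u.
Proof. exact: (cox_catr u (cox_sq r)). Qed.

Definition adjacent s t := (t == ordS s) || (s == ordS t).

Lemma cox_comm_cons s t u : ~~ adjacent s t ->
  cox_equiv (s :: t :: u) (t :: s :: u).
Proof.
rewrite negb_or => /andP[ts st].
exact: (@cox_catr [:: s; t] [:: t; s]) (cox_comm ts st).
Qed.

Lemma cox_braid_cons s t u : adjacent s t -> (2 < n)%N ->
  cox_equiv [:: s, t, s & u] [:: t, s, t & u].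
Proof.
move=> adj n_gt2; apply: (@cox_catr [:: s; t; s] [:: t; s; t]).
case/orP: adj => /eqP ->; first exact: cox_braid.
by apply: cox_sym; exact: cox_braid.
Qed.

Lemma code_ordS s la : is_core n la ->
  exists k, forall x, code n la ((ordS s : nat)%:Z + x)
    = code n la ((s : nat)%:Z + 1 + x) - k.
Proof. by move=> cla; exact: (periodic_res n_gt1 (periodic_code n_gt1 cla) (dvd_ordS s)). Qed.

Lemma code_addn la x : is_core n la -> code n la (x + n%:Z) = code n la x - 1.
Proof. by move=> cla; exact: (periodic_code n_gt1 cla). Qed.

(** For n = 2 the position x + 2 is x + n, where the code is smaller by 1. This excludes the case
    without braid relation. *)
Lemma n_gt2_code la x : is_core n la -> code n la x <= code n la (x + 1 + 1) -> (2 < n)%N.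
Proof.
move=> cla le_c; rewrite ltn_neqAle n_gt1 andbT; apply/eqP => n2.
move: le_c; have -> : x + 1 + 1 = x + n%:Z by lia.
by rewrite code_addn //; lia.
Qed.

Lemma desc_ordS s la : is_core n la ->
  asc (ordS s) (core_act (ordS s) la) =
  (code n la ((s : nat)%:Z + 1) < code n la ((s : nat)%:Z + 1 + 1)).
Proof.
move=> cla; rewrite asc_core_act //; have [k ek] := code_ordS s cla.
by have := ek 0; rewrite !addr0 ek => ->; rewrite ltrD2r.
Qed.

Lemma code_act_ordS s la : is_core n la ->
  code n (core_act (ordS s) la) = act n ((s : nat)%:Z + 1) (code n la).
Proof.
by move=> cla; rewrite code_act // act_ordS //; exact: (periodic_code n_gt1 cla).
Qed.

Lemma core_act_fixP s la : is_core n la -> core_act s la = la ->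
  code n la ((s : nat)%:Z + 1) = code n la (s : nat)%:Z.
Proof.
move=> cla fix_s; apply: le_anti; rewrite !leNgt -ascE //.
have := asc_core_act n_gt1 s cla; rewrite fix_s => <-.
by rewrite andbb; apply/negP => /(ht_asc n_gt1 cla); rewrite fix_s; lia.
Qed.

(** Two adjacent descents mean that the code increases strictly over three consecutive positions;
    reversing these values takes three exchanges, each at a descent. *)
Lemma adjacent_desc2 s t la : is_core n la -> adjacent s t ->
  asc s (core_act s la) -> asc t (core_act t la) ->
  [/\ (2 < n)%N, asc t (core_act t (core_act s la)) &
      asc s (core_act s (core_act t (core_act s la)))].
Proof.
move=> cla; have cact r' la' := @is_core_act n n_gt1 r' la'.
rewrite /adjacent => /orP[] /eqP ->.
  rewrite asc_core_act // desc_ordS //; set c := code n la; set x := (s : nat)%:Z.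
  move=> lt_s lt_t; have n_gt2 : (2 < n)%N by apply: (n_gt2_code (x := x) cla); rewrite -/c; lia.
  rewrite desc_ordS ?asc_core_act //; do ?apply/cact => //.
  rewrite code_act_ordS ?code_act //; last exact/cact.
  rewrite -/c -/x !act_at // act_at1 //; split=> //.
    by rewrite act_off; lia.
  by rewrite (act_off n_gt1 (r := x + 1)) ?(act_off n_gt1 (x := x + 1 + 1)) ?act_at //; lia.
rewrite desc_ordS // asc_core_act //; set c := code n la; set x := (t : nat)%:Z.
move=> lt_s lt_t; have n_gt2 : (2 < n)%N by apply: (n_gt2_code (x := x) cla); rewrite -/c; lia.
rewrite desc_ordS ?asc_core_act //; do ?apply/cact => //.
rewrite (code_act n_gt1 t) ?code_act_ordS //; last exact/cact.
rewrite -/c -/x act_at1 // act_at //; split=> //.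
  by rewrite (act_off n_gt1 (r := x + 1)); lia.
by rewrite (act_off n_gt1 (r := x)) ?act_at1 ?(act_off n_gt1 (r := x + 1)) //; lia.
Qed.

(** The two values exchanged by [s] are equal, and [t] shares one of their positions. Undoing the
    increase at [t] replaces one of them and leaves an increase at [s]. *)
Lemma adjacent_fix_desc s t la : is_core n la -> adjacent s t ->
  core_act s la = la -> asc t (core_act t la) ->
  (2 < n)%N /\ asc s (core_act s (core_act t la)).
Proof.
move=> cla; have cact r' la' := @is_core_act n n_gt1 r' la'.
rewrite /adjacent => /orP[] /eqP -> /(core_act_fixP cla).
  rewrite desc_ordS //; set c := code n la; set x := (s : nat)%:Z.
  move=> eq_s lt_t; have n_gt2 : (2 < n)%N by apply: (n_gt2_code (x := x) cla); rewrite -/c; lia.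
  rewrite asc_core_act ?code_act_ordS //; last exact/cact.
  by rewrite -/c -/x act_at // act_off; lia.
have [k ek] := code_ordS t cla; rewrite ek -[X in _ = _ _ _ X]addr0 ek addr0.
rewrite asc_core_act //; set c := code n la; set x := (t : nat)%:Z.
move=> eq_s lt_t; have n_gt2 : (2 < n)%N by apply: (n_gt2_code (x := x) cla); rewrite -/c; lia.
rewrite desc_ordS ?code_act //; last exact/cact.
by rewrite -/c -/x act_at1 // act_off; lia.
Qed.

Lemma dvd_ord s t : (n%:Z %| (t : nat)%:Z - (s : nat)%:Z)%Z = (t == s).
Proof. by rewrite -eqz_mod_dvd !modz_nat eqz_nat !modn_small. Qed.

Lemma dvd_ord1 s t : (n%:Z %| (t : nat)%:Z - (s : nat)%:Z - 1)%Z = (t == ordS s).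
Proof.
rewrite -dvd_ord; apply: (dvd_congr n_gt1).
have -> : (t : nat)%:Z - (s : nat)%:Z - 1 - ((t : nat)%:Z - (ordS s : nat)%:Z) =
  (ordS s : nat)%:Z - ((s : nat)%:Z + 1) by lia.
exact: dvd_ordS.
Qed.

Lemma commuting_desc2 s t la : is_core n la -> ~~ adjacent s t -> s != t ->
  asc s (core_act s la) -> asc t (core_act t la) ->
  asc t (core_act t (core_act s la)).
Proof.
move=> cla; rewrite negb_or => /andP[ts st] neq_st _.
rewrite !asc_core_act //; last exact: is_core_act.
rewrite code_act // /act.
rewrite dvd_ord dvd_ord1 (negbTE ts) eq_sym (negbTE neq_st).
have -> : (t : nat)%:Z + 1 - (s : nat)%:Z = - ((s : nat)%:Z - (t : nat)%:Z - 1) by lia.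
rewrite (_ : - _ - 1 = (t : nat)%:Z - (s : nat)%:Z); last by lia.
by rewrite rpredN dvd_ord1 dvd_ord (negbTE st) eq_sym (negbTE neq_st).
Qed.

(** The words [s :: p] and [t :: q] are the two reduced words of the longest element generated by
    [s] and [t], of length 3 or 2 according to adjacency; [mu] is [la] with that element undone. *)
Lemma two_desc s t la : is_core n la -> s != t ->
  asc s (core_act s la) -> asc t (core_act t la) ->
  exists p q mu, [/\ is_core n mu, cox_equiv (s :: p) (t :: q), size p = size q,
    core_act_word (s :: p) mu = la & ht n la = (ht n mu + (size p).+1)%N].
Proof.
move=> cla neq_st ds dt; have cact r la' := @is_core_act n n_gt1 r la'.
have ht1 := ht_desc n_gt1 cla ds.
have [adj|nadj] := boolP (adjacent s t).
  have [n_gt2 d2 d3] := adjacent_desc2 cla adj ds dt.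
  have ht2 := ht_desc n_gt1 (cact _ _ cla) d2.
  have ht3 := ht_desc n_gt1 (cact _ _ (cact _ _ cla)) d3.
  exists [:: t; s], [:: s; t], (core_act s (core_act t (core_act s la))); split=> //.
  - by do 3!apply/cact.
  - exact: cox_braid_cons.
  - by rewrite /= !core_actK //; do 2?apply/cact.
  - by rewrite /=; lia.
have d2 := commuting_desc2 cla nadj neq_st ds dt.
have ht2 := ht_desc n_gt1 (cact _ _ cla) d2.
exists [:: t], [:: s], (core_act t (core_act s la)); split=> //.
- by do 2!apply/cact.
- exact: cox_comm_cons.
- by rewrite /= !core_actK //; do 2?apply/cact.
- by rewrite /=; lia.
Qed.

Lemma asc_word_consD r u : asc_word (r :: u) [::] ->
  asc_word u [::] /\ asc r (core_act r (core_act_word (r :: u) [::])).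
Proof.
move=> /= /andP[asc_u asc_r]; split=> //.
by rewrite core_actK //; exact: is_core_word (core_nil n).
Qed.

(* Matsumoto's argument: two distinct first letters s and t are both descents of
   the target, which is therefore obtained from a smaller core by the longest
   word in s and t. *)
Lemma asc_word_equiv u v : asc_word u [::] -> asc_word v [::] ->
  core_act_word u [::] = core_act_word v [::] -> cox_equiv u v.
Proof.
have cnil := core_nil n; have cw x := is_core_word n_gt1 x cnil.
have [k] := ubnP (size u); elim: k => // k IH in u v *; rewrite ltnS => le_k.
move=> asc_u asc_v eq_uv; have /(asc_wordP n_gt1 _ cnil) hu := asc_u.
have /(asc_wordP n_gt1 _ cnil) hv := asc_v.
have {hu hv} size_uv : size u = size v by move: hu; rewrite eq_uv hv; lia.
case: u => [|s u] in le_k asc_u eq_uv size_uv *.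
  by case: v size_uv {asc_v eq_uv} => // _; exact: cox_refl.
case: v => [|t v] // in asc_v eq_uv size_uv *.
have [asc_u' ds] := asc_word_consD asc_u; have [asc_v' dt] := asc_word_consD asc_v.
rewrite -eq_uv in dt; move: le_k size_uv => /= le_k [size_uv].
have [eq_st|neq_st] := eqVneq s t.
  rewrite -eq_st /= in eq_uv *; apply/cox_cons/IH => //.
  by rewrite -[LHS](core_actK n_gt1 s) ?cw // eq_uv core_actK ?cw.
have [p [q [mu [cmu pq size_pq p_mu ht_mu]]]] := two_desc (cw (s :: u)) neq_st ds dt.
(* Any ascending word [w] for [mu] completes [s :: p] and [t :: q] to ascending words for the common
   target. *)
have [w [asc_w w_mu]] := asc_word_ex n_gt1 cmu.
have sp_target : core_act_word (s :: p ++ w) [::] = core_act_word (s :: u) [::].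
  by rewrite -cat_cons core_act_cat w_mu.
have tq_target : core_act_word (t :: q ++ w) [::] = core_act_word (t :: v) [::].
  by rewrite -eq_uv -sp_target -!cat_cons !(core_act_equiv n_gt1 (cox_catr w pq)).
have asc_sp : asc_word (s :: p ++ w) [::].
  apply/(asc_wordP n_gt1 _ cnil); rewrite sp_target ht_mu -w_mu.
  by rewrite (asc_wordP n_gt1 _ cnil asc_w) /= size_cat; lia.
have asc_tq : asc_word (t :: q ++ w) [::].
  apply/(asc_wordP n_gt1 _ cnil); rewrite tq_target -eq_uv ht_mu -w_mu.
  by rewrite (asc_wordP n_gt1 _ cnil asc_w) /= size_cat size_pq; lia.
have tail r x y : asc_word (r :: x) [::] -> asc_word (r :: y) [::] ->
    core_act_word (r :: x) [::] = core_act_word (r :: y) [::] -> (size x < k)%N ->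
    cox_equiv (r :: x) (r :: y).
  move=> /asc_word_consD[asc_x _] /asc_word_consD[asc_y _] /= eq_xy lt_x.
  apply/cox_cons/IH => //.
  by rewrite -[LHS](core_actK n_gt1 r) ?cw // eq_xy core_actK ?cw.
(* The chain is s u, s p w, t q w, t v: the outer links share their first letter and follow by
   induction, the middle one is the relation between [s :: p] and [t :: q]. *)
apply: cox_trans (tail s u _ asc_u asc_sp (esym sp_target) le_k) _.
apply: cox_trans (cox_catr w pq) _; apply: cox_sym.
by apply: (tail t v _ asc_v asc_tq (esym tq_target)); rewrite -size_uv.
Qed.

Definition parabolic_word p := all (fun r : 'I_n => val r != 0%N) p.

Lemma asc_nil r : asc r [::] = (val r == 0%N).
Proof.
rewrite /asc /= orbF /addable /= /has_residue add0n mod0n modn_small ?ltn_ord //.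
Qed.

Lemma parabolic_nil p : parabolic_word p -> core_act_word p [::] = [::].
Proof.
elim: p => //= r p IH /andP[r_neq0 /IH->].
by rewrite /core_act -/(asc r [::]) asc_nil (negbTE r_neq0).
Qed.

(** Induction on the length, with t the first letter of the word. If [r] commutes with t it moves
    past t. If they are adjacent, the rest of the word can be rewritten as r w, and r t r w becomes
    t r t w, where t fixes the core of w and the induction applies. *)
Lemma fix_word r u : asc_word u [::] ->
  core_act r (core_act_word u [::]) = core_act_word u [::] ->
  exists2 p, parabolic_word p & cox_equiv (r :: u) (u ++ p).
Proof.
have cnil := core_nil n; have cw x := is_core_word n_gt1 x cnil.
have cact r' la' := @is_core_act n n_gt1 r' la'.
have [k] := ubnP (size u); elim: k => // k IH in r u *; rewrite ltnS => le_k.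
case: u le_k => [_ _ /= fix_r|t u /= lt_k asc_tu fix_r].
  exists [:: r]; last exact: cox_refl.
  rewrite /= andbT -asc_nil; apply/negP => a.
  by have := ht_asc n_gt1 cnil a; rewrite fix_r; lia.
have [asc_u dt] := asc_word_consD asc_tu; rewrite /= in dt.
set la := core_act t (core_act_word u [::]) in fix_r dt.
have cla : is_core n la by apply/cact.
have u_la : core_act_word u [::] = core_act t la by rewrite core_actK ?cw.
have [adj|nadj] := boolP (adjacent r t).
  have [n_gt2 dr] := adjacent_fix_desc cla adj fix_r dt.
  set mu := core_act r (core_act t la).
  have cmu : is_core n mu by do 2!apply/cact.
  have [w [asc_w w_mu]] := asc_word_ex n_gt1 cmu.
  have mu_r : core_act r mu = core_act t la by rewrite core_actK //; apply/cact.
  (* The braid relation applied to [la], which [r] fixes, reads mu = s_t mu. *)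
  have fix_t : core_act t mu = mu.
    have /= := core_act_equiv n_gt1 (cox_braid_cons [::] adj n_gt2) cla.
    by rewrite -/mu fix_r => <-.
  have u_rw : cox_equiv u (r :: w).
    by apply: asc_word_equiv; rewrite //= w_mu ?asc_w ?mu_r.
  have size_u : size u = (size w).+1.
    have /(asc_wordP n_gt1 _ cnil) := asc_u; have /(asc_wordP n_gt1 _ cnil) := asc_w.
    have := ht_desc n_gt1 (cact t _ cla) dr; rewrite -/mu w_mu u_la; lia.
  have [p par_p tw] := IH t w ltac:(lia) asc_w ltac:(by rewrite w_mu).
  exists p => //; apply: cox_trans (cox_cons r (cox_cons t u_rw)) _.
  apply: cox_trans (cox_braid_cons w adj n_gt2) _.
  apply: cox_trans (cox_cons t (cox_cons r tw)) _.
  by apply: cox_sym; exact: (cox_cons t (cox_catr p u_rw)).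
have fix_r' : core_act r (core_act_word u [::]) = core_act_word u [::].
  have /= := core_act_equiv n_gt1 (cox_comm_cons [::] nadj) cla.
  by rewrite fix_r u_la.
have [p par_p ru] := IH r u lt_k asc_u fix_r'; exists p => //.
apply: cox_trans (cox_comm_cons u nadj) _; exact: (cox_cons t ru).
Qed.

(** The coset decomposition is built letter by letter: an ascent lengthens [v], a descent cancels
    against a first letter of [v], and a letter fixing the core passes into the parabolic factor by
    [fix_word]. *)
Lemma asc_parabolic_factor u : exists v p,
  [/\ asc_word v [::], parabolic_word p & cox_equiv u (v ++ p)].
Proof.
have cnil := core_nil n; have cw x := is_core_word n_gt1 x cnil.
elim: u => [|r u [v [p [asc_v par_p uvp]]]].
  by exists [::], [::]; split=> //; exact: cox_refl.
have [a|a|fix_r] := step_cases n_gt1 r (cw v).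
- exists (r :: v), p; split=> //; first by rewrite /= asc_v.
  exact: (cox_cons r uvp).
- have [w [asc_w w_la]] := asc_word_ex n_gt1 (is_core_act n_gt1 r (cw v)).
  exists w, p; split=> //; apply: cox_trans (cox_cons r uvp) _.
  rewrite -cat_cons; apply: cox_catr; apply: cox_trans (cox_sq_cons r w).
  apply/cox_cons/asc_word_equiv => //=; rewrite w_la ?asc_w // core_actK //.
- have [q par_q rv] := fix_word asc_v fix_r.
  exists v, (q ++ p); split=> //; first by rewrite /parabolic_word all_cat -!/(parabolic_word _) par_q.
  apply: cox_trans (cox_cons r uvp) _; rewrite -cat_cons catA; exact: cox_catr.
Qed.

Lemma len_le u : (len (word_elt u) <= size u)%N.
Proof.
rewrite /len; case: ex_minnP => m _; apply; apply/existsP.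
by exists (in_tuple u).
Qed.

Lemma reduced_word_ex (x : affS n) : exists u, reduced_word x u.
Proof.
rewrite /reduced_word /len; case: ex_minnP => m /existsP[u /eqP ux] _.
by exists u; rewrite size_tuple.
Qed.

Lemma affS_mul_word u v : (word_elt u * word_elt v)%g = word_elt (u ++ v).
Proof. exact: affS_mulE. Qed.

Section CoreElt.

Variables (la : seq nat) (v : seq 'I_n).
Hypotheses (asc_v : asc_word v [::]) (v_la : core_act_word v [::] = la).

Lemma size_asc_le u : core_act_word u [::] = la -> (size v <= size u)%N.
Proof.
move=> u_la; have cnil := core_nil n.
have [] := ht_word n_gt1 u cnil; rewrite u_la -v_la (asc_wordP n_gt1 _ cnil asc_v); lia.
Qed.

(** The core reached depends only on the group element, and each letter gains at most one unit of
    height, so no word for this element is shorter than [v]. *)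
Lemma len_asc_word : len (word_elt v) = size v.
Proof.
apply/eqP; rewrite eqn_leq len_le /=.
have [u [/word_eltP uv <-]] := reduced_word_ex (word_elt v).
by apply: size_asc_le; rewrite (core_act_equiv n_gt1 uv (core_nil n)).
Qed.

(** Multiplying on the right by a parabolic element does not change the core reached from the empty
    one, so [v] is of minimal length in its coset. For uniqueness, a competitor factors as w p with
    w equivalent to [v]; minimality against the inverse of p bounds its length by [size v], so its
    reduced word ascends and is equivalent to [v]. *)
Lemma core_elt_asc_word : core_elt n la = word_elt v.
Proof.
have cnil := core_nil n; apply: xget_unique => [|x [min_x [u [ux size_u] u_la]]].
  split; last by exists v => //; split=> //; rewrite len_asc_word.
  move=> _ [q par_q <-]; rewrite affS_mul_word len_asc_word.
  have [u [/word_eltP uvq <-]] := reduced_word_ex (word_elt (v ++ q)).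
  apply: size_asc_le; rewrite (core_act_equiv n_gt1 uvq cnil) core_act_cat.
  by rewrite parabolic_nil.
have [w [p [asc_w par_p uwp]]] := asc_parabolic_factor u.
have w_la : core_act_word w [::] = la.
  by rewrite -u_la (core_act_equiv n_gt1 uwp cnil) core_act_cat (parabolic_nil par_p).
have wv : cox_equiv w v by apply: asc_word_equiv => //; rewrite w_la.
have xp : (x * word_elt (rev p))%g = word_elt v.
  rewrite -ux affS_mul_word; apply/word_eltP.
  apply: cox_trans (cox_catr _ uwp) _; rewrite -catA -[v]cats0.
  apply: cox_cat wv _; rewrite -{1}(revK p); exact: cox_rev_cat.
have par_rev : in_parabolic (word_elt (rev p)).
  by exists (rev p) => //; rewrite all_rev.
have := min_x _ par_rev; rewrite xp len_asc_word -size_u => le_u.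
rewrite -ux; apply/word_eltP/asc_word_equiv => //; last by rewrite u_la.
apply/(asc_wordP n_gt1 _ cnil); rewrite u_la -v_la (asc_wordP n_gt1 _ cnil asc_v).
by have := size_asc_le u_la; lia.
Qed.

Lemma core_deg_asc_word : core_deg n la = size v.
Proof. by rewrite /core_deg core_elt_asc_word len_asc_word. Qed.

End CoreElt.

Lemma ht_core_deg la : is_core n la -> ht n la = (ht n [::] + core_deg n la)%N.
Proof.
move=> /(asc_word_ex n_gt1)[v [asc_v v_la]]; rewrite (core_deg_asc_word asc_v v_la).
by rewrite -v_la; apply/(asc_wordP n_gt1 _ (core_nil n)).
Qed.

(** Length additivity says exactly that a reduced word of the quotient gains one unit of height per
    letter from [la] to [nu]. Conversely such a word, followed by an ascending word for [la], is an
    ascending word for [nu]. *)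
Lemma cyc_decreasing_asc_word la nu : is_core n la -> is_core n nu ->
  (cyc_decreasing (core_elt n nu * (core_elt n la)^-1)%g /\
   len (core_elt n nu) =
     (len (core_elt n la) + len (core_elt n nu * (core_elt n la)^-1)%g)%N) <->
  exists u, [/\ cyc_decreasing_word u, asc_word u la & core_act_word u la = nu].
Proof.
move=> cla cnu; have cnil := core_nil n.
have [v [asc_v v_la]] := asc_word_ex n_gt1 cla.
have [w [asc_w w_nu]] := asc_word_ex n_gt1 cnu.
rewrite (core_elt_asc_word asc_v v_la) (core_elt_asc_word asc_w w_nu).
rewrite (len_asc_word asc_v v_la) (len_asc_word asc_w w_nu).
have ht_la : ht n la = (ht n [::] + size v)%N.
  by rewrite -v_la; apply/(asc_wordP n_gt1 _ cnil).
have ht_nu : ht n nu = (ht n [::] + size w)%N.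
  by rewrite -w_nu; apply/(asc_wordP n_gt1 _ cnil).
split=> [[[u [ux size_u] cd_u] add_len]|[u [cd_u asc_u u_nu]]].
  have u_nu : core_act_word u la = nu.
    rewrite -v_la -core_act_cat -w_nu; apply: core_act_equiv (cnil) => //.
    by apply/word_eltP; rewrite -affS_mul_word ux mulgVK.
  exists u; split=> //; apply/(asc_wordP n_gt1 _ cla).
  by rewrite u_nu ht_nu ht_la size_u add_len; lia.
have uvw : (word_elt w * (word_elt v)^-1)%g = word_elt u.
  apply: (canLR (mulgK _)); rewrite affS_mul_word; apply/word_eltP.
  apply: asc_word_equiv => //; last by rewrite core_act_cat v_la u_nu.
  by rewrite asc_word_cat asc_v v_la.
have size_w : size w = (size v + size u)%N.
  by have := asc_wordP n_gt1 _ cla asc_u; rewrite u_nu; lia.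
(* Any word leading from [la] to [nu] has at least as many letters as the difference of heights, so
   [u] is reduced. *)
have len_u : len (word_elt u) = size u.
  apply/eqP; rewrite eqn_leq len_le /=.
  have [u' [/word_eltP u'u <-]] := reduced_word_ex (word_elt u).
  have [] := ht_word n_gt1 u' cla; rewrite (core_act_equiv n_gt1 u'u cla) u_nu; lia.
by rewrite uvw len_u; split=> //; exists u.
Qed.

End Words.

Local Close Scope ring_scope.

(** * Containment and lifting *)

Lemma bottom_row_max la p : is_part la -> bead la p -> (p <= (nth 0%N la 0%N)%:Z)%R.
Proof.
by move=> pla [i ->]; have := is_part_nth_le pla (leq0n i); rewrite /edge; lia.
Qed.


Section Containment.

Variable n : nat.
Hypothesis n_gt1 : 1 < n.
Implicit Types (la mu nu ga : seq nat) (u : seq 'I_n) (r : 'I_n).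

Lemma subpart_trans la mu nu : subpart la mu -> subpart mu nu -> subpart la nu.
Proof. by move=> lamu munu i; apply: leq_trans (lamu i) (munu i). Qed.

(* The lifting property of the strong order: removing the corners of a residue
   which is a descent of the larger core preserves the containment. *)
Lemma subpart_ht la mu : is_core n la -> is_core n mu -> subpart la mu ->
  ht n la <= ht n mu ?= iff (la == mu).
Proof.
have [k] := ubnP (ht n mu); elim: k => // k IH in la mu *; rewrite ltnS => le_k.
move=> cla cmu sub; have [pla _] := cla; have [pmu _] := cmu.
have [mu0|mu_neq0] := EM (mu = [::]).
  suff -> : la = mu by split; rewrite ?eqxx.
  apply: is_part_ext => // i.
  by apply/eqP; rewrite eqn_leq sub mu0 nth_nil leq0n.
have [r desc_mu] := desc_ex n_gt1 cmu mu_neq0.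
have ht_mu := ht_desc n_gt1 cmu desc_mu.
have cmu' := is_core_act n_gt1 r cmu.
have := subpart_remove_corners r pla pmu sub.
rewrite -(core_act_desc n_gt1 cmu desc_mu).
have [desc_la|ndesc_la] := boolP (asc r (core_act r la)).
  rewrite -(core_act_desc n_gt1 cla desc_la) => sub'.
  have cla' := is_core_act n_gt1 r cla; have ht_la := ht_desc n_gt1 cla desc_la.
  have [le_ht eq_ht] := IH (core_act r la) (core_act r mu) ltac:(lia) cla' cmu' sub'.
  split; first lia.
  have -> : (la == mu) = (core_act r la == core_act r mu).
    apply/eqP/eqP => [-> //|eq_act].
    by rewrite -(core_actK n_gt1 r cla) eq_act core_actK.
  by rewrite -eq_ht ht_la ht_mu eqSS.
rewrite (remove_corners_id n_gt1 cla (negbTE ndesc_la)) => sub'.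
have [le_ht _] := IH la (core_act r mu) ltac:(lia) cla cmu' sub'.
split; first lia.
have /negbTE -> : la != mu by apply: contraNneq ndesc_la => ->.
by apply/negbTE; rewrite neq_ltn ht_mu ltnS le_ht.
Qed.

(** This is the 0-Hecke action of the word: letters that are not ascents are skipped. Unlike
    [core_act_word] it is monotone for containment. *)
Definition up_word u la := foldr (@add_corners n) la u.

Lemma add_cornersE r la : is_core n la ->
  add_corners r la = if asc r la then core_act r la else la.
Proof.
move=> cla; have [pla _] := cla; case: ifP => [a|na].
  by rewrite core_act_asc.
exact: add_corners_id.
Qed.

Lemma up_word_core u la : is_core n la -> is_core n (up_word u la).
Proof.
move=> cla; elim: u => //= r u IH; rewrite add_cornersE //; case: ifP => // _.
exact: is_core_act.
Qed.

Lemma up_word_asc u la : is_core n la -> asc_word u la ->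
  up_word u la = core_act_word u la.
Proof.
move=> cla; elim: u => //= r u IH /andP[/IH-> asc_r].
by rewrite core_act_asc.
Qed.

Lemma ht_up_word u la : is_core n la ->
  ht n (up_word u la) <= ht n la + size u ?= iff asc_word u la.
Proof.
move=> cla; elim: u => [|r u [IH IHe]] /=; first by rewrite addn0; split; rewrite ?eqxx.
have cu := up_word_core u cla.
have : ht n (add_corners r (up_word u la)) = ht n (up_word u la) + asc r (up_word u la).
  by rewrite add_cornersE //; case: ifP => a; rewrite ?addn0 // ht_asc ?addn1.
move=> ht_add; split; first lia.
have [au|nau] /= := boolP (asc_word u la).
  by rewrite -up_word_asc // ht_add; move: IHe; rewrite au => /eqP ->; case: asc; lia.
by move: IHe; rewrite (negbTE nau) => /eqP; case: asc ht_add => /= ht_add ? ; lia.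
Qed.

Lemma subpart_up_word_self u la : is_core n la -> subpart la (up_word u la).
Proof.
move=> cla; elim: u => //= r u IH i; apply: leq_trans (IH i) _.
by have [pu _] := up_word_core u cla; rewrite nth_add_corners ?leq_addr.
Qed.

Lemma subpart_up_word u la mu : is_core n la -> is_core n mu ->
  subpart la mu -> subpart (up_word u la) (up_word u mu).
Proof.
move=> cla cmu sub; elim: u => //= r u IH.
by apply: subpart_add_corners IH; [case: (up_word_core u cla)|case: (up_word_core u cmu)].
Qed.

Lemma bottom_row_asc r la : is_core n la -> asc r la ->
  nth 0 (core_act r la) 0 = nth 0 la 0 + has_residue r 0 (nth 0 la 0).
Proof. by case=> pla _ /core_act_asc ->; rewrite nth_add_corners. Qed.

Lemma bottom_row_word u la : is_core n la -> asc_word u la ->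
  all (fun r => ~~ has_residue r 0 (nth 0 la 0)) u ->
  nth 0 (core_act_word u la) 0 = nth 0 la 0.
Proof.
move=> cla; elim: u => //= r u IH /andP[asc_u asc_r] /andP[nr /(IH asc_u) eq_u].
by rewrite bottom_row_asc ?eq_u ?(negbTE nr) ?addn0 //; exact: is_core_word.
Qed.

Lemma asc_bottom_row r la : has_residue r 0 (nth 0 la 0) -> asc r la.
Proof. by move=> res; apply/has_addableP; exists 0; rewrite /addable res. Qed.

(* An addable corner of this residue would put a bead beyond the bottom row. *)
Lemma not_asc_pred_bottom r la : is_core n la ->
  has_residue (ordS r) 0 (nth 0 la 0) -> asc r la = false.
Proof.
move=> cla; have [pla _] := cla; have lac := codeP n_gt1 cla.
rewrite has_residueE => dr.
set M := Posz (nth 0 la 0) in dr.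
have cM : (0 <= code n la M)%R.
  by have := code_edge lac 0; rewrite /edge subr0.
have dM : (n%:Z %| (M - 1 - (r : nat)%:Z)%R)%Z.
  by have := rpredD dr (dvd_ordS r); congr (_ %| _)%Z; lia.
rewrite ascE // -(code_succ_ltr n_gt1 pla lac dM) subrK.
apply/negbTE; rewrite -leNgt; apply/negP => lt_c.
have : bead la (M - 1 + n%:Z)%R.
  case: (lac) => pc bc; apply/bc; rewrite pc; lia.
by move/(bottom_row_max pla); rewrite -/M; lia.
Qed.

End Containment.

(** * Strips *)

Lemma gtn_trans : transitive gtn.
Proof. by move=> x y z /= xy yz; apply: ltn_trans yz xy. Qed.

Lemma path_gtn_weaken k l s : k <= l -> path gtn k s -> path gtn l s.
Proof. by case: s => //= x s le_kl /andP[lt_x ->]; rewrite andbT; lia. Qed.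

Lemma path_gtn_rev_iota q k : q <= k -> path gtn k (rev (iota 0 q)).
Proof.
elim: q k => // q IH k lt_qk; rewrite -addn1 iotaD rev_cat /= lt_qk.
exact: IH.
Qed.

Lemma rev_iotaS q : rev (iota 0 q.+1) = q :: rev (iota 0 q).
Proof. by rewrite -addn1 iotaD rev_cat. Qed.

Lemma path_gtn_size k s : path gtn k s -> size s <= k.
Proof.
elim: s k => //= x s IH k /andP[lt_x /IH le_x]; exact: leq_ltn_trans le_x lt_x.
Qed.

Lemma path_gtn_all k s : path gtn k s -> all (fun i => i < k) s.
Proof. exact: (order_path_min gtn_trans). Qed.

(* q is the first offset missing from s. *)
Lemma path_gtn_split k s : path gtn k s -> exists q s',
  s = s' ++ rev (iota 0 q) /\ (s' = [::] /\ q = k \/ path gtn k (rcons s' q)).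
Proof.
elim: s k => [|j s IH] k /=.
  move=> _; exists 0, [::]; split=> //.
  by case: k => [|k]; [left|right].
case/andP=> lt_j /IH[q [s' [-> [[-> ->]|path_q]]]].
  exists j.+1, [::]; rewrite rev_iotaS; split=> //=.
  by have [<-|ne_j] := eqVneq j.+1 k; [left|right; rewrite andbT ltn_neqAle ne_j].
by exists q, (j :: s'); split=> //; right; rewrite /= lt_j.
Qed.

Section Strips.

Variable n : nat.
Hypothesis n_gt1 : 1 < n.

Lemma ordS_neq (r : 'I_n) : ordS r != r.
Proof.
rewrite -val_eqE /=; have := ltn_ord r; rewrite leq_eqVlt => /orP[/eqP eq_r|lt_r].
  by rewrite eq_r modnn; lia.
by rewrite modn_small //; lia.
Qed.

(** The pairwise form is inherited by subwords and splits along concatenations. *)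
Lemma cyc_decreasing_wordP (u : seq 'I_n) : cyc_decreasing_word u <->
  uniq u /\ pairwise (fun x y => y != ordS x) u.
Proof.
split=> [[uniq_u cd_u]|[uniq_u pw_u]]; split=> //.
  case: u uniq_u cd_u => [//|x0 u]; set s := x0 :: u => uniq_s cd_s.
  apply/(pairwiseP x0) => i j; rewrite !inE => lt_i lt_j lt_ij.
  apply/eqP => eq_j; have := cd_s (nth x0 s i); rewrite -eq_j !mem_nth //.
  by rewrite !index_uniq // => /(_ isT isT); lia.
move=> i iu Siu; case: ltngtP => // [lt_i|eq_i].
  have /(pairwiseP i)/(_ (index i u) (index (ordS i) u)) := pw_u.
  by rewrite !inE !index_mem !nth_index // eqxx => /(_ iu Siu lt_i).
have /eqP := ordS_neq i; case.
by rewrite -(nth_index i Siu) eq_i nth_index.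
Qed.

Variable la : seq nat.
Hypothesis cla : is_core n la.
Let pla : is_part la := proj1 cla.
Let M := nth 0 la 0.
Implicit Types (u : seq 'I_n) (r : 'I_n) (s : seq nat).

(* The letter which moves a bead from the position M + i to M + i + 1, where M
   is the last bead of la. *)
Definition letter (i : nat) : 'I_n := Ordinal (ltn_pmod (M + i) (ltnW n_gt1)).

(** Words are recorded by offsets from [M], so that cyclic decrease, once the letter M - 1 is
    avoided, becomes ordinary decrease of numbers below n - 1. *)
Definition strip s : seq nat := core_act_word (map letter s) la.

Definition asc_strip s : bool := asc_word (map letter s) la.

Lemma letter_inj i j : i < n -> j < n -> letter i = letter j -> i = j.
Proof.
move=> lt_i lt_j [] /eqP; rewrite eqn_modDl !modn_small // => /eqP.
by [].
Qed.

Lemma ordS_letter i : ordS (letter i) = letter i.+1.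
Proof. by apply: val_inj; rewrite /= -addn1 modnDml addn1 addnS. Qed.

Lemma letter_onto r : exists2 i, i < n & r = letter i.
Proof.
have inj_l : injective (fun i : 'I_n => letter i).
  by move=> i j /letter_inj eq_ij; apply: val_inj; exact: eq_ij.
by have /codomP[i ->] := injF_onto inj_l r; exists i.
Qed.

Lemma has_residue_letter i x : has_residue (letter i) 0 x = (x == M + i %[mod n]).
Proof. by rewrite /has_residue add0n /= modn_mod. Qed.

Lemma eqmod_lt x y : x < y -> y < x + n -> (x == y %[mod n]) = false.
Proof.
move=> lt_xy lt_y; apply/negbTE; rewrite eq_sym eqn_mod_dvd ?(ltnW lt_xy) //.
by apply/negP => /dvdn_leq; lia.
Qed.

Lemma is_core_strip s : is_core n (strip s).
Proof. exact: is_core_word. Qed.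

Lemma strip_bottom_le k s : path gtn k s -> asc_strip s ->
  nth 0 (strip s) 0 <= M + k.
Proof.
elim: s k => [|j s IH] k /=; first by rewrite leq_addr.
rewrite /asc_strip /= => /andP[lt_j /IH path_s] /andP[asc_s asc_j].
rewrite /strip /= bottom_row_asc //; last exact: is_core_strip.
by have := path_s asc_s; rewrite /strip; case: has_residue; lia.
Qed.

(* The largest letter of the strip is peeled off both sides by lifting. *)
Lemma cover_strip k s mu : k <= n.-1 -> path gtn k s -> asc_strip s ->
  is_core n mu -> subpart mu (strip s) -> ht n (strip s) = (ht n mu).+1 ->
  M <= nth 0 mu 0 < nth 0 (strip s) 0 ->
  exists s', [/\ subseq s' s, asc_strip s' & mu = strip s'].
Proof.
elim: s k mu => [|j s IH] k mu le_k /=.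
  by move=> _ _ _ _ _; rewrite /strip /= -/M; lia.
rewrite /asc_strip => /andP[lt_j path_s] asc_js cmu sub ht_mu bot_mu.
have := asc_js => /= /andP[asc_s asc_j]; set r := letter j in asc_j *.
set ga := strip (j :: s) in sub ht_mu bot_mu *.
have cga1 := is_core_strip s; have [pmu _] := cmu.
have cga : is_core n ga by exact: is_core_strip.
have [pga _] := cga.
have ga_r : core_act r ga = strip s by rewrite /ga /strip /= core_actK.
have desc_ga : asc r (core_act r ga) by rewrite ga_r.
have bot_ga : nth 0 ga 0 = nth 0 (strip s) 0 + has_residue r 0 (nth 0 (strip s) 0).
  exact: bottom_row_asc.
have bot_s : nth 0 (strip s) 0 <= M + j := strip_bottom_le path_s asc_s.
have ht_ga := ht_desc n_gt1 cga desc_ga; rewrite ga_r in ht_ga.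
have := subpart_remove_corners r pmu pga sub.
rewrite -(core_act_desc n_gt1 cga desc_ga) ga_r.
have [desc_mu|ndesc_mu] := boolP (asc r (core_act r mu)); last first.
  (* If [r] is not a descent of [mu], then [mu] lies inside [strip s] and has the same height: the
     cover just drops the offset [j]. *)
  rewrite (remove_corners_id n_gt1 cmu (negbTE ndesc_mu)) => sub'.
  have [_] := subpart_ht n_gt1 cmu cga1 sub'.
  have -> : ht n mu = ht n (strip s) by case: (etrans (esym ht_mu) ht_ga).
  rewrite eqxx => /esym/eqP mu_s; exists s; split=> //.
  exact: subseq_cons.
rewrite -(core_act_desc n_gt1 cmu desc_mu) => sub'.
have cmu' := is_core_act n_gt1 r cmu; have ht_mu' := ht_desc n_gt1 cmu desc_mu.
(* The bottom row of [mu] has length between M and M + j, so the residue of its last cell is one of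
   M - 1, ..., M + j - 1, which differ from M + j modulo n as j < n - 1. *)
have bot_mu' : nth 0 (core_act r mu) 0 = nth 0 mu 0.
  rewrite (core_act_desc n_gt1 cmu desc_mu) nth_remove_corners //.
  suff -> : removable r mu 0 = false by rewrite subn0.
  rewrite /removable; case: ltnP => //= lt_mu.
  have le_bot : nth 0 ga 0 <= M + j.+1.
    by rewrite bot_ga addnS -addn1; apply: leq_add bot_s _; case: has_residue.
  have le_jn : j.+1 <= n.-1 := leq_trans lt_j le_k.
  rewrite has_residue_letter eqmod_lt //; clear -lt_mu bot_mu le_bot le_jn; lia.
have nres_mu : ~~ has_residue r 0 (nth 0 mu 0).
  by apply: contraFN (desc_not_asc n_gt1 cmu desc_mu); exact: asc_bottom_row.
(* If [r] extends the bottom row of [strip s], equality of the bottom rows would make [r] addable on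
   [mu], although it is a descent there. *)
have lt_bot : M <= nth 0 (core_act r mu) 0 < nth 0 (strip s) 0.
  have [le_M] := andP bot_mu; rewrite bot_mu' le_M bot_ga /=.
  case res: has_residue; last by rewrite addn0.
  rewrite addn1 ltnS leq_eqVlt => /orP[/eqP eq_mu|//].
  by rewrite eq_mu res in nres_mu.
have ht_s : ht n (strip s) = (ht n (core_act r mu)).+1.
  by rewrite -ht_mu'; case: (etrans (esym ht_ga) ht_mu).
have le_j : j <= n.-1 := ltnW (leq_trans lt_j le_k).
have [s' [sub_s asc_s' eq_mu]] := IH j _ le_j path_s asc_s cmu' sub' ht_s lt_bot.
exists (j :: s'); split; first by rewrite /= eqxx.
  by rewrite /asc_strip /= -/(asc_strip s') asc_s' -/(strip s') -eq_mu.
by rewrite /strip /= -/(strip s') -eq_mu core_actK.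
Qed.

(** Offsets below n - 1 do not wrap around: the successor of [letter i] has offset i + 1 < n, and so
    occurs only earlier in a decreasing list. *)
Lemma strip_cyc_decreasing s : path gtn n.-1 s -> cyc_decreasing_word (map letter s).
Proof.
move=> path_s; apply/cyc_decreasing_wordP.
have lt_s i : i \in s -> i < n.-1 by move/(allP (path_gtn_all path_s)).
split.
  rewrite map_inj_in_uniq; last first.
    by move=> i j /lt_s lt_i /lt_s lt_j; apply: letter_inj; lia.
  apply: (sorted_uniq gtn_trans); last exact: path_sorted path_s.
  by move=> i /=; rewrite ltnn.
rewrite pairwise_map; apply/(pairwiseP 0) => i j; rewrite !inE => lt_i lt_j lt_ij.
have gt_ij := sorted_ltn_nth gtn_trans 0 (path_sorted path_s) i j lt_i lt_j lt_ij.
rewrite /= ordS_letter; apply/eqP => /letter_inj eq_ij.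
have := lt_s _ (mem_nth 0 lt_i); have := lt_s _ (mem_nth 0 lt_j).
by move: eq_ij gt_ij => /=; lia.
Qed.

(** This letter is the residue M - 1. The letters applied before it avoid its successor M by cyclic
    decrease, so the bottom row still has length M when it is applied, and then it is not an
    ascent. *)
Lemma letter_last_notin u : cyc_decreasing_word u -> asc_word u la ->
  letter n.-1 \notin u.
Proof.
move=> /cyc_decreasing_wordP[_ pw_u] asc_u; apply/negP => in_u.
case/splitPr: in_u pw_u asc_u => a b.
rewrite pairwise_cat pairwise_cons => /and3P[_ _ /andP[all_b _]].
rewrite asc_word_cat => /andP[/= /andP[asc_b asc_n] _].
have bot_b : nth 0 (core_act_word b la) 0 = M.
  apply: bottom_row_word => //; apply: sub_all all_b => r.
  rewrite ordS_letter prednK ?(ltnW n_gt1) //; apply: contraNN.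
  rewrite /has_residue add0n -/M => /eqP res; apply/eqP/val_inj => /=.
  by rewrite modnDr res modn_small.
move: asc_n; rewrite not_asc_pred_bottom //; first exact: is_core_word.
rewrite ordS_letter prednK ?(ltnW n_gt1) // bot_b has_residue_letter.
by rewrite modnDr.
Qed.

Lemma cox_move_front (x : 'I_n) a b : all (fun y => ~~ adjacent y x) a ->
  cox_equiv (a ++ x :: b) (x :: a ++ b).
Proof.
elim: a => [_|y a IH /=]; first exact: cox_refl.
case/andP=> nadj /IH eq_a; apply: cox_trans (cox_cons y eq_a) _.
exact: cox_comm_cons.
Qed.

(** The letter of the largest offset moves to the front: its predecessor cannot stand to its left by
    cyclic decrease, its successor is outside the allowed range, and all other letters commute with
    it. *)
Lemma cyc_decreasing_sort t u : t <= n.-1 -> cyc_decreasing_word u ->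
  (forall r, r \in u -> exists2 i, i < t & r = letter i) ->
  exists s, [/\ path gtn t s, cox_equiv u (map letter s) & size u = size s].
Proof.
elim: t u => [|t IH] u le_t cd_u u_t.
  case: u {cd_u} u_t => [_|r u /(_ r (mem_head _ _)) []//].
  by exists [::]; split=> //; exact: cox_refl.
have /cyc_decreasing_wordP[uniq_u pw_u] := cd_u.
have lt_t r : r != letter t -> (exists2 i, i < t.+1 & r = letter i) ->
    exists2 i, i < t & r = letter i.
  move=> ne_r [i lt_i eq_r]; exists i => //; rewrite ltn_neqAle -ltnS lt_i andbT.
  by apply: contraNneq ne_r => <-; rewrite eq_r.
have [in_u|nin_u] := boolP (letter t \in u); last first.
  have [||s [path_s us size_s]] := IH u _ cd_u; first lia.
    move=> r ru; apply: lt_t (u_t r ru).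
    by apply: contraNneq nin_u => <-.
  by exists s; split=> //; apply: path_gtn_weaken path_s.
case/splitPr: in_u uniq_u pw_u u_t {cd_u} => a b uniq_u pw_u u_t.
have ne_t r : r \in a ++ b -> r != letter t.
  move: uniq_u; rewrite -cat1s uniq_catCA cat1s cons_uniq => /andP[nin _] r_ab.
  by apply: contraNneq nin => <-.
have sub_ab : subseq (a ++ b) (a ++ letter t :: b).
  by apply: cat_subseq => //; exact: subseq_cons.
have cd_ab : cyc_decreasing_word (a ++ b).
  apply/cyc_decreasing_wordP; split; first exact: subseq_uniq sub_ab uniq_u.
  exact: subseq_pairwise sub_ab pw_u.
have ab_t r : r \in a ++ b -> exists2 i, i < t & r = letter i.
  by move=> r_ab; exact: lt_t (ne_t r r_ab) (u_t r (mem_subseq sub_ab r_ab)).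
have [s [path_s abs size_s]] := IH (a ++ b) ltac:(lia) cd_ab ab_t.
exists (t :: s); split; first by rewrite /= ltnSn.
- apply: cox_trans (cox_cons (letter t) abs); apply: cox_move_front.
  apply/allP => r ra; rewrite negb_or; apply/andP; split.
    move: pw_u; rewrite pairwise_cat => /and3P[/allrelP rel_ab _ _].
    by apply: rel_ab => //; exact: mem_head.
  have [i lt_i ->] := ab_t r ltac:(by rewrite mem_cat ra).
  by rewrite ordS_letter; apply/eqP => /letter_inj; lia.
- by rewrite size_cat /= addnS -size_cat size_s.
Qed.

Lemma cyc_decreasing_strip u : cyc_decreasing_word u -> asc_word u la ->
  exists s, [/\ path gtn n.-1 s, asc_strip s & core_act_word u la = strip s].
Proof.
move=> cd_u asc_u.
have [|s [path_s us size_s]] := cyc_decreasing_sort (leqnn n.-1) cd_u.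
  move=> r ru; have [i lt_i eq_r] := letter_onto r; exists i => //.
  rewrite ltn_neqAle -ltnS prednK ?(ltnW n_gt1) // lt_i andbT.
  by apply: contraTneq ru => eq_i; rewrite eq_r eq_i letter_last_notin.
have u_s := core_act_equiv n_gt1 us cla; exists s; split=> //.
apply/(asc_wordP n_gt1 _ cla); rewrite -u_s (asc_wordP n_gt1 _ cla asc_u).
by rewrite size_map size_s.
Qed.

(** The letters M, M + 1, and so on extend the bottom row one cell at a time, and the bottom row
    always has an addable corner. *)
Lemma run_strip q : asc_strip (rev (iota 0 q)) /\ nth 0 (strip (rev (iota 0 q))) 0 = M + q.
Proof.
elim: q => [|q [asc_q bot_q]]; first by rewrite addn0.
have res : has_residue (letter q) 0 (nth 0 (strip (rev (iota 0 q))) 0).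
  by rewrite bot_q has_residue_letter.
have asc_l := asc_bottom_row res.
rewrite rev_iotaS /asc_strip /strip /= -/(strip _); split.
  by apply/andP; split.
by rewrite bottom_row_asc ?res ?bot_q ?addn1 ?addnS //; exact: is_core_strip.
Qed.

(** The smallest missing offset q is inserted below the larger offsets [s2]. The runs without and
    with q give cores A inside A', and the 0-Hecke action of [s2] preserves this containment. The
    bottom rows differ, so the height grows by at least one, which is also the most it can grow;
    hence all letters of [s2] remain ascents. *)
Lemma strip_extend s : path gtn n.-1 s -> asc_strip s -> size s < n.-1 ->
  exists s', [/\ path gtn n.-1 s', asc_strip s', size s' = (size s).+1,
    subpart (strip s) (strip s') & nth 0 (strip s) 0 < nth 0 (strip s') 0].
Proof.
move=> path_s; have [q [s2 [-> cases]]] := path_gtn_split path_s.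
rewrite size_cat size_rev size_iota => asc_s lt_size.
(* A list with fewer than n - 1 offsets misses one of them. *)
have {cases} path_q : path gtn n.-1 (rcons s2 q).
  by case: cases => // -[s2_nil eq_q]; move: lt_size; rewrite s2_nil eq_q ltnn.
have [asc_run bot_run] := run_strip q; have [asc_run' bot_run'] := run_strip q.+1.
set A := strip (rev (iota 0 q)) in bot_run; set A' := strip _ in bot_run'.
have cA : is_core n A := is_core_strip _; have cA' : is_core n A' := is_core_strip _.
have strip_cat s1 : strip (s2 ++ s1) = core_act_word (map letter s2) (strip s1).
  by rewrite /strip map_cat core_act_cat.
have asc_cat s1 : asc_strip (s2 ++ s1) =
    asc_strip s1 && asc_word (map letter s2) (strip s1).
  by rewrite /asc_strip map_cat asc_word_cat.
move: asc_s; rewrite asc_cat => /andP[_ asc_s2].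
have A'E : A' = core_act (letter q) A by rewrite /A' rev_iotaS.
have asc_q : asc (letter q) A.
  by apply: asc_bottom_row; rewrite bot_run has_residue_letter.
have subA : subpart A A'.
  rewrite A'E; apply: subpart_core_act_up asc_q; exact: (proj1 cA).
have htA' : ht n A' = (ht n A).+1 by rewrite A'E; exact: ht_asc.
(* The offsets in [s2] lie strictly between q and n - 1, so none of these letters can extend a
   bottom row of length M + q. *)
have bot_X : nth 0 (strip (s2 ++ rev (iota 0 q))) 0 = M + q.
  rewrite strip_cat bottom_row_word //; apply/allP => _ /mapP[j j_s2 ->].
  have := path_sorted path_q; rewrite (sorted_pairwise gtn_trans) pairwise_rcons.
  move=> /andP[/allP/(_ j j_s2) /= lt_qj _].
  have := path_gtn_all path_q; rewrite all_rcons => /andP[_ /allP/(_ j j_s2) lt_jn].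
  rewrite bot_run has_residue_letter eqmod_lt ?ltn_add2l // -addnA ltn_add2l.
  by clear -lt_jn lt_qj; lia.
set u2 := map letter s2 in strip_cat asc_cat asc_s2 *.
have X_up := up_word_asc cA asc_s2; rewrite -strip_cat in X_up.
have subXY := subpart_up_word n_gt1 u2 cA cA' subA; rewrite X_up in subXY.
have bot_Y : M + q.+1 <= nth 0 (up_word u2 A') 0.
  by rewrite -bot_run'; exact: (subpart_up_word_self n_gt1 u2 cA' 0).
have [leXY eqXY] := subpart_ht n_gt1 (is_core_strip _) (up_word_core n_gt1 u2 cA') subXY.
have [leY eqY] := ht_up_word n_gt1 u2 cA'.
have ht_X := asc_wordP n_gt1 u2 cA asc_s2; rewrite -strip_cat in ht_X.
have ne_XY : (strip (s2 ++ rev (iota 0 q)) == up_word u2 A') = false.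
  apply/negbTE/eqP => eq; move: bot_Y; rewrite -eq bot_X.
  by rewrite leq_add2l ltnn.
rewrite ne_XY in eqXY.
(* The height of the larger core is squeezed between ht X + 1 and ht A' + [size s2], which are
   equal. *)
have asc_Y : asc_word u2 A'.
  rewrite -eqY eqn_leq leY htA' /= addSn -ht_X ltn_neqAle leXY andbT.
  by rewrite eqXY.
have Y_up := up_word_asc cA' asc_Y; rewrite -strip_cat in Y_up.
exists (s2 ++ rev (iota 0 q.+1)); rewrite asc_cat asc_run' asc_Y -Y_up; split=> //.
- rewrite rev_iotaS -cat_rcons cat_path path_q last_rcons.
  exact: path_gtn_rev_iota.
- by rewrite size_cat size_rev size_iota addnS.
- by rewrite bot_X; apply: leq_trans bot_Y; rewrite addnS.
Qed.

(** * The core R(n-1, la) as the strip with all letters *)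

Local Open Scope ring_scope.

Let c := code n la.
Let lac : codes n la c := codeP n_gt1 cla.

Lemma code_bottom : c M%:Z = 0.
Proof.
have [pc bc] := lac; apply/eqP; rewrite eq_le; apply/andP; split.
  rewrite leNgt; apply/negP => c_gt0.
  have /(bottom_row_max pla) : bead la (M%:Z + n%:Z) by apply/bc; rewrite pc; lia.
  by rewrite -/M; lia.
by have := code_edge lac 0%N; rewrite /edge subr0.
Qed.

(** On the window from M the run acts as a cycle: it carries the value at M to M + q and shifts the
    values it passes one place to the left. *)
Lemma code_run q (p : int) : (q <= n.-1)%N -> M%:Z <= p -> p < M%:Z + n%:Z ->
  code n (strip (rev (iota 0 q))) p =
  if p < M%:Z + q%:Z then c (p + 1) else if p == M%:Z + q%:Z then c M%:Z else c p.
Proof.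
elim: q p => [|q IH] p le_q ge_p lt_p.
  rewrite addr0 ltNge ge_p /=; by case: eqVneq => [->|].
have cq := is_core_strip (rev (iota 0 q)).
have pcq := periodic_code n_gt1 cq.
have -> : code n (strip (rev (iota 0 q.+1))) =
    act n (M%:Z + q%:Z) (code n (strip (rev (iota 0 q)))).
  rewrite rev_iotaS /strip /= code_act //.
  apply: periodic_act_res => //.
  rewrite -[(_ %| _)%Z]eqz_mod_dvd /= -PoszD -modz_nat modz_mod; exact: eqxx.
have IHq x := IH x (ltnW le_q); move: (code n _) pcq IHq => cr pcr IHq.
clear IH cq; have le_q' : (q.+1 < n)%N by lia.
clearbody M; clear le_q.
have [lt_pq|] := ltP p (M%:Z + q%:Z).
  rewrite act_off ?IHq ?lt_pq; [|lia..].
  by have -> : p < M%:Z + q.+1%:Z by lia.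
rewrite le_eqVlt => /orP[/eqP<-|gt_p].
  rewrite act_at // IHq; [|lia..].
  have -> : (M%:Z + q%:Z + 1 < M%:Z + q%:Z) = false by lia.
  have -> : (M%:Z + q%:Z + 1 == M%:Z + q%:Z) = false by lia.
  by have -> : M%:Z + q%:Z < M%:Z + q.+1%:Z by lia.
have -> : (p < M%:Z + q.+1%:Z) = false by lia.
have [->|ne_p] := eqVneq p (M%:Z + q.+1%:Z).
  have -> : M%:Z + q.+1%:Z = M%:Z + q%:Z + 1 by lia.
  rewrite act_at1 // IHq; [|lia..].
  have -> : (M%:Z + q%:Z < M%:Z + q%:Z) = false by lia.
  by rewrite eqxx.
rewrite act_off ?IHq; [|lia..].
have -> : (p < M%:Z + q%:Z) = false by lia.
by have -> : (p == M%:Z + q%:Z) = false by lia.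
Qed.

Lemma is_part_strip_top : is_part (strip_top n la).
Proof.
have n1 : (0 < n - 1)%N by lia.
rewrite /is_part /strip_top inE negb_or eq_sym -lt0n addn_gt0 n1 orbT /=.
have [srt nz] := andP pla; rewrite nz andbT.
by case: (la) srt => //= a s ->; rewrite andbT leq_addr.
Qed.

(** Prepending a row moves every bead of [la] one position to the left and adds a bead at M + n - 1,
    which raises the code by 1 on the runner of M - 1. *)
Definition top_code (p : int) : int := c (p + 1) + (n%:Z %| p + 1 - M%:Z)%Z%:Z.

Lemma codes_strip_top : codes n (strip_top n la) top_code.
Proof.
have [pc bc] := lac.
have edge0 : edge (strip_top n la) 0 = M%:Z + n%:Z - 1.
  by rewrite /edge /= -nth0 -/M; clear -n_gt1; lia.
have edgeS i : edge (strip_top n la) i.+1 = edge la i - 1 by rewrite /edge /=; lia.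
split=> [p|p].
  rewrite /top_code (dvd_congr n_gt1 (q := p + 1 - M%:Z)); last first.
    by rewrite (_ : _ - (_ - _) = n%:Z) //; clear; lia.
  have -> : p + n%:Z + 1 = p + 1 + n%:Z by clear; lia.
  by rewrite pc addrAC.
rewrite /top_code; split=> [[[|i] ->]|].
- rewrite edge0 subrK pc code_bottom [_ + _ - M%:Z]addrAC subrr add0r dvdzz.
  by clear; lia.
- by rewrite edgeS subrK; have := code_edge lac i; clear; case: (_ %| _)%Z; lia.
have [/bc [i ei] _|lt0] := leP 0 (c (p + 1)).
  by exists i.+1; rewrite edgeS -ei addrK.
have [d|nd] := boolP (_ %| _)%Z; last by rewrite addr0 leNgt lt0.
(* The only bead not coming from [la] is the one with code value -1 at p + 1 on the runner of M;
   since c M = 0 this means p + 1 = M + n, the bead of the new row. *)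
move=> ge0; have eq_c : c (p + 1) = -1 by clear -lt0 ge0; lia.
exists 0%N; rewrite edge0; move: d eq_c => /dvdzP[k ek].
have -> : p + 1 = M%:Z + n%:Z * k by rewrite mulrC -ek; clear; lia.
rewrite (periodicM n_gt1) // code_bottom => k1.
have {}k1 : k = 1 by clear -k1; lia.
by move: ek; rewrite k1 mul1r; clear; lia.
Qed.

(** Both codes are the shift of [c] by one on the window from M except at its last position. There
    the run puts c M, which equals c (M + n) + 1, the value of [top_code]. *)
Lemma strip_full : strip (rev (iota 0 n.-1)) = strip_top n la.
Proof.
have cs := is_core_strip (rev (iota 0 n.-1)); have [ps _] := cs.
have ctop := codes_strip_top; have [ptop _] := ctop.
apply: (codes_inj ps is_part_strip_top (codeP n_gt1 cs)).
have -> // : code n (strip (rev (iota 0 n.-1))) = top_code.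
apply: (periodic_window n_gt1 (x := M%:Z)) => //.
  exact: (periodic_code n_gt1 cs).
move=> p lo hi; rewrite code_run // /top_code.
have [lt_p|] := ltP.
  suff /negbTE-> : ~~ (n%:Z %| p + 1 - M%:Z)%Z by rewrite addr0.
  apply/negP; rewrite /dvdz /= => /dvdn_leq.
  by clear -lo lt_p n_gt1; lia.
move=> ge_p; have -> : p = M%:Z + n.-1%:Z by clear -ge_p hi; lia.
rewrite eqxx (_ : M%:Z + _ + 1 = M%:Z + n%:Z); last by clear -n_gt1; lia.
by have [pc _] := lac; rewrite pc [_ + _ - M%:Z]addrAC subrr add0r dvdzz subrK.
Qed.

Local Close Scope ring_scope.

(** * Chains of strong covers and strips *)

Lemma ht_strip s : asc_strip s -> ht n (strip s) = ht n la + size s.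
Proof. by move=> /(asc_wordP n_gt1 _ cla); rewrite size_map. Qed.

Lemma strip_chain d s : path gtn n.-1 s -> asc_strip s -> size s + d = n.-1 ->
  exists ch : nat -> seq nat, [/\ ch 0 = strip s, ch d = strip_top n la &
    forall i, i < d -> strong_cover n (ch i) (ch i.+1) /\
                       head 0 (ch i) < head 0 (ch i.+1)].
Proof.
elim: d s => [|d IH] s path_s asc_s size_s.
  exists (fun=> strip s); split=> //; rewrite addn0 in size_s.
  have [q [s2 [eq_s [[s2_nil eq_q]|path_q]]]] := path_gtn_split path_s.
    by rewrite eq_s s2_nil eq_q strip_full.
  (* If an offset q were missing, inserting it would give n decreasing offsets below n - 1. *)
  have : path gtn n.-1 (rcons s2 q ++ rev (iota 0 q)).
    by rewrite cat_path path_q last_rcons path_gtn_rev_iota.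
  move/path_gtn_size; rewrite cat_rcons size_cat /= addnS -size_cat -eq_s size_s.
  by rewrite ltnn.
have [|s' [path_s' asc_s' size_s' sub bot]] := strip_extend path_s asc_s.
  by rewrite -size_s addnS ltnS leq_addr.
have [|ch [ch0 chd ch_lt]] := IH s' path_s' asc_s'.
  by rewrite size_s' addSn -addnS.
exists (fun i => if i is i'.+1 then ch i' else strip s); split=> // -[_|i].
  rewrite ch0 -!nth0; split=> //; split=> //; try exact: is_core_strip.
  apply/(@addnI (ht n [::])); rewrite addnA -!ht_core_deg //; try exact: is_core_strip.
  by rewrite !ht_strip // size_s' addn1 addnS.
exact: ch_lt.
Qed.

(** Each step down the chain is an instance of [cover_strip]. The containment of [la] in the lowest
    core passes up the chain and supplies the lower bound M on the bottom rows. *)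
Lemma chain_strip m (ch : nat -> seq nat) : subpart la (ch 0) ->
  ch m = strip_top n la ->
  (forall i, i < m -> strong_cover n (ch i) (ch i.+1) /\
                      head 0 (ch i) < head 0 (ch i.+1)) ->
  exists s, [/\ path gtn n.-1 s, asc_strip s & ch 0 = strip s].
Proof.
elim: m ch => [|m IH] ch sub_la chm ch_lt.
  exists (rev (iota 0 n.-1)); rewrite path_gtn_rev_iota // chm strip_full.
  by have [] := run_strip n.-1.
have [[c0 c1 sub01 deg01] bot01] := ch_lt 0 isT.
have [||i lt_i|s [path_s asc_s eq_s]] := IH (fun i => ch i.+1).
- exact: subpart_trans sub_la sub01.
- exact: chm.
- exact: ch_lt.
rewrite eq_s in sub01 bot01 deg01.
have ht01 : ht n (strip s) = (ht n (ch 0)).+1.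
  rewrite (ht_core_deg n_gt1 c0) (ht_core_deg n_gt1 (is_core_strip s)) deg01.
  by rewrite addn1 addnS.
have [|s' [sub_s asc_s' eq_s']] := cover_strip (leqnn n.-1) path_s asc_s c0 sub01 ht01.
  by rewrite -!nth0 in bot01; rewrite bot01 andbT; exact: sub_la.
exists s'; split=> //; exact: (subseq_path gtn_trans sub_s path_s).
Qed.

Lemma horizontal_strong_stripP nu : is_core n nu ->
  horizontal_strong_strip n la nu <->
  exists u, [/\ cyc_decreasing_word u, asc_word u la & core_act_word u la = nu].
Proof.
move=> cnu; split=> [[sub [m [ch [_ ch0 chm ch_lt]]]]|[u [cd_u asc_u u_nu]]].
  rewrite -ch0 in sub *; have [s [path_s asc_s eq_s]] := chain_strip sub chm ch_lt.
  by exists (map letter s); split=> //; exact: strip_cyc_decreasing.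
have [s [path_s asc_s eq_s]] := cyc_decreasing_strip cd_u asc_u.
have [|ch [ch0 chd ch_lt]] := strip_chain (d := n.-1 - size s) path_s asc_s.
  by rewrite subnKC // path_gtn_size.
split; last first.
  (* The degree of [nu] exceeds that of [la] by [size s], so this is the prescribed length of the
     chain. *)
  exists (n.-1 - size s), ch; split=> //; last by rewrite ch0 -eq_s.
  apply/(@addnI (ht n [::])); rewrite addnCA -ht_core_deg // addnCA -ht_core_deg //.
  by rewrite -u_nu eq_s ht_strip // addnCA subnK ?path_gtn_size // subn1 addnC.
rewrite -u_nu -up_word_asc //; exact: subpart_up_word_self.
Qed.

End Strips.

Theorem mainTheorem6 (n : nat) (hn : 2 <= n) (la nu : seq nat)
    (hla : is_core n la) (hnu : is_core n nu) :
  horizontal_strong_strip n la nu <->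
  cyc_decreasing (core_elt n nu * (core_elt n la)^-1)%g /\
  len (core_elt n nu) =
    len (core_elt n la) + len (core_elt n nu * (core_elt n la)^-1)%g.
Proof.
rewrite (horizontal_strong_stripP hn hla hnu).
by rewrite (cyc_decreasing_asc_word hn hla hnu).
Qed.
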